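(* Let $\mathcal{A}$ be the vertex set of a web-like graph with set of channels $\mathcal{C}$ and let $L=(L(\alpha,\beta))_{\alpha,\beta\in\mathcal{A}}$ be the associated operator on $\ell^2(\mathcal{A})$ (as described in the context). Let $u\in C^1([0,1],\ell^2(\mathcal{A}))$ be a solution of $$\partial_t u(t,\alpha)=i\sum_{\beta\in\mathcal{A}}L(\alpha,\beta)u(t,\beta),\qquad t\in[0,1],\ \alpha\in\mathcal{A}.$$ Let $\nu_0\in\mathcal{C}$. If for some $\epsilon>0$ and some constant $C>0$ $$|u(t,\nu_0(k))|\le C\Big(\frac{e}{(2+\epsilon)k}\Big)^k,\qquad k>0,\quad t\in\{0,1\},$$ then $u(t,\nu_0(k))=0$ for all $t\in[0,1]$ and all $k\ge 0$.
   Context: Web-like system. $\mathcal{A}$ is a countable set (of ''particles'' or vertices) and $L=(L(\alpha,\beta))_{\alpha,\beta\in\mathcal{A}}$ is a real-valued symmetric matrix defining a positive selfadjoint operator $L:\ell^2(\mathcal{A})\to\ell^2(\mathcal{A})$. Two distinct vertices $\alpha,\beta$ are joined by an edge iff $L(\alpha,\beta)\ne0$; the resulting graph is connected. There is a finite set $\mathcal{C}=\{\nu_1,\dots,\nu_N\}$ of channels; each channel $\nu\in\mathcal{C}$ is an infinite sequence $\nu=\{\nu(k)\}_{k\ge0}$ of vertices with $L(\nu(k),\nu(n))=0$ if $|n-k|>1$, and for each $k\ge1$ the vertex $\nu(k)$ is joined by an edge to $\nu(k-1)$ and $\nu(k+1)$ and to no other vertex. Put $\mathcal{A}_0=\bigcup_{\nu\in\mathcal{C}}\bigcup_{k\ge1}\{\nu(k)\}$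 (the vertices $\nu(k)$, $\nu\in\mathcal{C}$, $k\ge1$, being pairwise distinct) and $\mathcal{A}_1=\mathcal{A}\setminus\mathcal{A}_0$. The set $\mathcal{A}_1$ is finite, contains all $\nu(0)$, $\nu\in\mathcal{C}$, and the only pairs $(\alpha,\beta)\in\mathcal{A}_1\times\mathcal{A}_0$ with $L(\alpha,\beta)\neq0$ are $(\nu(0),\nu(1))$, $\nu\in\mathcal{C}$. For $\nu\in\mathcal{C}$ and $k\ge1$ write $-b_\nu(k-1)=L(\nu(k-1),\nu(k))$ and $a_\nu(k)=L(\nu(k),\nu(k))$. It is assumed that there is $K_0>0$ such that $b_\nu(k)=1$ and $a_\nu(k)=2$ for all $k\ge K_0$ and all $\nu\in\mathcal{C}$. *)

(* Defs.v *)
From HB Require Import structures.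
From mathcomp Require Import all_boot all_order all_algebra.
From mathcomp Require Import all_classical all_reals all_analysis.
From mathcomp Require Import complex.

Set Implicit Arguments.
Unset Strict Implicit.
Unset Printing Implicit Defensive.

Import Order.TTheory GRing.Theory Num.Theory.
Import numFieldNormedType.Exports.
Import ComplexField.Normc.

Local Open Scope classical_set_scope.
Local Open Scope ring_scope.
Local Open Scope complex_scope.

Section ell2.
Variables (R : realType) (A : countType).
Implicit Types (f g : A -> R[i]).

(* The norm takes the value +oo exactly off l^2(A): there is no junk value. *)
Definition ell2norm f : \bar R :=
  ((\esum_(a in [set: A]) ((normc (f a)) ^+ 2)%:E) `^ 2^-1)%E.

Definition ell2 : set (A -> R[i]) := [set f | (ell2norm f < +oo)%E].

(* Unconditional sums over A: [esum] only sums nonnegative families, so a real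
   family is split into positive and negative parts, and a complex one into
   real and imaginary parts. Meaningful for absolutely summable families, in
   particular in [ell2inner] on l^2(A), and in [matop] for a web-like L, whose
   rows are finitely supported. *)
Definition rsum (h : A -> R) : R :=
  fine (\esum_(a in [set: A]) (Num.max (h a) 0)%:E)
  - fine (\esum_(a in [set: A]) (Num.max (- h a) 0)%:E).

Definition csum (h : A -> R[i]) : R[i] :=
  rsum (fun a => complex.Re (h a)) +i* rsum (fun a => complex.Im (h a)).

Definition ell2inner f g : R[i] := csum (fun a => f a * (g a)^*%C).

Definition matop (L : A -> A -> R) f : A -> R[i] :=
  fun a => csum (fun b => (L a b)%:C * f b).

(* The operator is defined on all of l^2(A), so selfadjointness is symmetry
   (and boundedness follows, by Hellinger-Toeplitz). The order on R[i] makes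
   [0 <= z] mean that z is real and nonnegative. *)
Record positive_selfadjoint (L : A -> A -> R) : Prop := {
  psa_ell2 : forall f, ell2 f -> ell2 (matop L f);
  psa_selfadjoint : forall f g, ell2 f -> ell2 g ->
    ell2inner (matop L f) g = ell2inner f (matop L g);
  psa_positive : forall f, ell2 f -> 0 <= ell2inner (matop L f) f }.

(* u belongs to C^1([0,1], l^2(A)) with derivative du, all limits being taken
   in the l^2 norm and inside [0,1] (hence one-sided at the endpoints). Values
   of u and du outside [0,1] are irrelevant. *)
Record C1_ell2 (u du : R -> A -> R[i]) : Prop := {
  C1_ell2_val : forall t : R, t \in `[0, 1] -> ell2 (u t);
  C1_ell2_dval : forall t : R, t \in `[0, 1] -> ell2 (du t);
  C1_ell2_derive : forall t : R, t \in `[0, 1] ->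
    ell2norm (fun a => ((s - t)^-1)%:C * (u s a - u t a) - du t a)
      @[s --> within `[0, 1] t^'] --> (0 : \bar R);
  C1_ell2_continuous : forall t : R, t \in `[0, 1] ->
    ell2norm (fun a => du s a - du t a)
      @[s --> within `[0, 1] (nbhs t)] --> (0 : \bar R) }.

End ell2.

Section web.
Variables (R : realType) (A : countType) (L : A -> A -> R).

Definition edge : rel A := fun a b => (a != b) && (L a b != 0).

Variables (N : nat) (nu : 'I_N -> nat -> A).

Definition channel_vertices : set A :=
  [set a | exists c k, (0 < k)%N /\ a = nu c k].

Definition core_vertices : set A := ~` channel_vertices.

Definition web_a (c : 'I_N) (k : nat) : R := L (nu c k) (nu c k).

Definition web_b (c : 'I_N) (k : nat) : R := - L (nu c k) (nu c k.+1).

Record web_like : Prop := {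
  web_sym : forall a b, L a b = L b a;
  web_psa : positive_selfadjoint L;
  web_connected : forall a b, exists p, path edge a p /\ last a p = b;
  web_tridiag : forall c k n, (1 < `|k%:Z - n%:Z|)%N ->
    L (nu c k) (nu c n) = 0;
  web_channel : forall c k, (0 < k)%N -> forall b,
    edge (nu c k) b <-> b = nu c k.-1 \/ b = nu c k.+1;
  web_distinct : forall c c' k k', (0 < k)%N -> (0 < k')%N ->
    nu c k = nu c' k' -> c = c' /\ k = k';
  web_core_finite : finite_set core_vertices;
  web_core_root : forall c, core_vertices (nu c 0);
  web_core_link : forall a b, core_vertices a -> channel_vertices b ->
    L a b != 0 -> exists c, a = nu c 0 /\ b = nu c 1;
  web_free : exists K0 : nat, (0 < K0)%N /\
    forall c k, (K0 <= k)%N -> web_b c k = 1 /\ web_a c k = 2 }.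

End web.

(* Main.v *)
(** Far out on the channel nu0 the equation is a free half-line equation whose
    boundary value g(t) = u(t, nu0(K)) is unknown. After a gauge transformation
    it reads q_k' = q_(k+1) - q_(k-1), for real q. Pair q with f_k = Q_k(d/dt) h,
    where h(s) = Im 1/(s - x - iy) and f_k' = f_(k+1) - f_(k-1), f_0 = 0. For
    large y this expresses the Poisson integral of g at x + iy through the
    values of q at t = 0 and t = 1. Since the data decay like rho^k/k! with
    rho < 1/2, those boundary series converge for every y >= 0 as long as x
    lies in the gap (rho, 1 - rho), outside the discs of radius rho around 0
    and 1. So the identity continues down to y = 0, where the boundary terms
    vanish while the Poisson integral tends to a multiple of g(x). Hence g = 0
    on the gap, and as the channel coefficients b do not vanish, u = 0 on the
    whole channel for these t. Finally L has uniformly bounded row sums, so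
    t |-> u(t, a) is analytic and vanishes on all of [0, 1]. *)

Require Import Defs.
From HB Require Import structures.
From mathcomp Require Import all_boot all_order all_algebra.
From mathcomp Require Import all_classical all_reals all_analysis.
From mathcomp Require Import complex.
From mathcomp Require Import ring lra zify.

Set Implicit Arguments.
Unset Strict Implicit.
Unset Printing Implicit Defensive.

Import Order.TTheory GRing.Theory Num.Theory.
Import numFieldNormedType.Exports.
Import ComplexField.Normc.

Local Open Scope classical_set_scope.
Local Open Scope ring_scope.
Local Open Scope complex_scope.

(** * Derivatives on an interval, Taylor bounds, primitives *)

Section deriv_on.
Context {R : realType}.
Implicit Types (a b c d t : R) (f g df dg : R -> R).

(** The continuation to small y meets an obstacle. For t strictly inside (0,1) the only bound
    obtained on q_k is 3^k/k!, while f_k grows like k!/y^k, so the interior terms q_(N+1) f_N + q_N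
    f_(N+1) are directly small only for large y. At t = 0 and t = 1, however, rho^k/k! faces k!/r^k
    with r up to the distance between the endpoint and the pole x + iy, and this ratio stays below 1
    for every y. For fixed N the defect of the identity is therefore read in two ways: as the
    integral of the interior terms, which is small at y = 24, and as boundary terms plus the
    integral of q_0 h, which see the jet of h only at 0 and 1. The second form is bounded uniformly
    in N, so the Taylor series of h in y can be exchanged with the limit in N, and finitely many
    short steps lead from y = 24 to any y in (0,1]. The number 2 in the decay hypothesis is what
    makes rho < 1/2: the discs around 0 and 1 are then disjoint and the gap contains 1/2. All of
    this is carried out with real pairs and real Taylor bounds instead of complex function
    theory. *)

Lemma within_continuousD a b f g : {within `[a, b], continuous f} ->
  {within `[a, b], continuous g} ->
  {within `[a, b], continuous (fun t => f t + g t)}.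
Proof.
move=> cf cg t.
by apply: (@continuousD _ _ (subspace `[a, b])); [exact: cf|exact: cg].
Qed.

Lemma within_continuousN a b f : {within `[a, b], continuous f} ->
  {within `[a, b], continuous (fun t => - f t)}.
Proof.
by move=> cf t; apply: (@continuousN _ _ (subspace `[a, b])); exact: cf.
Qed.

Lemma within_continuousM a b f g : {within `[a, b], continuous f} ->
  {within `[a, b], continuous g} ->
  {within `[a, b], continuous (fun t => f t * g t)}.
Proof.
move=> cf cg t.
by apply: (@continuousM _ (subspace `[a, b])); [exact: cf|exact: cg].
Qed.

Lemma within_continuous_cst a b (k : R) :
  {within `[a, b], continuous (fun=> k)}.
Proof. by move=> t; exact: cvg_cst. Qed.

Lemma within_continuous_sum (I : Type) (s : seq I) a b (f : I -> R -> R) :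
  (forall i, {within `[a, b], continuous (f i)}) ->
  {within `[a, b], continuous (fun t => \sum_(i <- s) f i t)}.
Proof.
move=> cf; elim: s => [|i s IH].
  have -> : (fun t => \sum_(i <- [::]) f i t) = fun=> 0.
    by apply/funext => t; rewrite big_nil.
  exact: within_continuous_cst.
have -> : (fun t => \sum_(j <- i :: s) f j t) =
          (fun t => f i t + \sum_(j <- s) f j t).
  by apply/funext => t; rewrite big_cons.
exact: within_continuousD.
Qed.

(** Continuity up to the endpoints and derivatives only inside are the hypotheses of the mean value
    theorem; the curves t |-> u(t, a) have only one-sided derivatives at 0 and 1. *)
Definition deriv_on a b f df : Prop :=
  {within `[a, b], continuous f} /\
  forall t, t \in `]a, b[ -> is_derive t 1 f (df t).

Lemma deriv_on_eq a b f g df dg : (forall t, f t = g t) ->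
  (forall t, t \in `]a, b[ -> df t = dg t) ->
  deriv_on a b f df -> deriv_on a b g dg.
Proof.
move=> /funext <- dfg [cf Df]; split=> // t tab.
by rewrite -dfg//; exact: Df.
Qed.

Lemma deriv_onD a b f g df dg : deriv_on a b f df -> deriv_on a b g dg ->
  deriv_on a b (fun t => f t + g t) (fun t => df t + dg t).
Proof.
move=> [cf Df] [cg Dg]; split=> [|t tab]; first exact: within_continuousD.
have ? := Df _ tab; have ? := Dg _ tab; exact: is_deriveD.
Qed.

Lemma deriv_onN a b f df : deriv_on a b f df ->
  deriv_on a b (fun t => - f t) (fun t => - df t).
Proof.
move=> [cf Df]; split=> [|t tab]; first exact: within_continuousN.
have ? := Df _ tab; exact: is_deriveN.
Qed.

Lemma deriv_onB a b f g df dg : deriv_on a b f df -> deriv_on a b g dg ->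
  deriv_on a b (fun t => f t - g t) (fun t => df t - dg t).
Proof. by move=> Df /deriv_onN; exact: deriv_onD. Qed.

Lemma deriv_onM a b f g df dg : deriv_on a b f df -> deriv_on a b g dg ->
  deriv_on a b (fun t => f t * g t) (fun t => df t * g t + f t * dg t).
Proof.
move=> [cf Df] [cg Dg]; split=> [|t tab]; first exact: within_continuousM.
have ? := Df _ tab; have ? := Dg _ tab.
apply: is_derive_eq; rewrite addrC /GRing.scale /=; congr (_ + _).
exact: mulrC.
Qed.

Lemma deriv_on_full a b f df :
  (forall t, t \in `[a, b] -> is_derive t 1 f (df t)) -> deriv_on a b f df.
Proof.
move=> Df; split=> [|t tab]; last by apply: Df; exact: subset_itv_oo_cc.
apply: derivable_within_continuous => t tab.
by have [] := Df _ tab.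
Qed.

Lemma deriv_on_cst a b (k : R) : deriv_on a b (fun=> k) (fun=> 0).
Proof. by apply: deriv_on_full => t _; exact: is_derive_cst. Qed.

Lemma deriv_onZ a b (k : R) f df : deriv_on a b f df ->
  deriv_on a b (fun t => k * f t) (fun t => k * df t).
Proof.
move=> Df; apply: deriv_on_eq (deriv_onM (deriv_on_cst a b k) Df) => // t _.
by rewrite mul0r add0r.
Qed.

Lemma deriv_on_sum (I : Type) (s : seq I) a b (f df : I -> R -> R) :
  (forall i, deriv_on a b (f i) (df i)) ->
  deriv_on a b (fun t => \sum_(i <- s) f i t) (fun t => \sum_(i <- s) df i t).
Proof.
move=> Df; elim: s => [|i s IH].
  by apply: deriv_on_eq (deriv_on_cst a b 0) => t; rewrite big_nil.
by apply: deriv_on_eq (deriv_onD (Df i) IH) => t; rewrite big_cons.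
Qed.

Lemma deriv_onS a b c d f df : a <= c -> d <= b ->
  deriv_on a b f df -> deriv_on c d f df.
Proof.
move=> ac db [cf Df]; split.
  by apply: continuous_subspaceW cf; apply: subset_itv; rewrite bnd_simp.
move=> t /andP[/= ct td]; apply: Df; rewrite in_itv/=.
by apply/andP; split; [exact: le_lt_trans ct|exact: lt_le_trans db].
Qed.

Lemma deriv_on_mono a b f df : a <= b -> deriv_on a b f df ->
  (forall t, t \in `]a, b[ -> 0 <= df t) -> f a <= f b.
Proof.
move=> + [cf Df] df0; rewrite le_eqVlt => /predU1P[->//|ab].
have [c' c'ab fab'] := MVT ab Df cf.
by rewrite -subr_ge0 fab' mulr_ge0 ?df0// subr_ge0 ltW.
Qed.

Lemma deriv_on_le a b f df g dg : a <= b ->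
  deriv_on a b f df -> deriv_on a b g dg ->
  (forall t, t \in `]a, b[ -> `|df t| <= dg t) -> `|f b - f a| <= g b - g a.
Proof.
move=> ab Df Dg fg; rewrite ler_norml; apply/andP; split.
- have := deriv_on_mono ab (deriv_onD Dg Df) => /= H.
  suff : g a + f a <= g b + f b by lra.
  apply: H => t tab.
  by have := fg _ tab; rewrite ler_norml => /andP[]; lra.
- have := deriv_on_mono ab (deriv_onB Dg Df) => /= H.
  suff : g a - f a <= g b - f b by lra.
  apply: H => t tab; rewrite subr_ge0.
  by have := fg _ tab; rewrite ler_norml => /andP[].
Qed.

End deriv_on.

Section taylor.
Context {R : realType}.
Implicit Types (a d t z C : R) (f : nat -> R -> R).

Lemma is_derive_powfact a t m :
  is_derive t 1 (fun s => (s - a) ^+ m.+1 / m.+1`!%:R) ((t - a) ^+ m / m`!%:R).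
Proof.
pose g : R -> R := (m.+1`!%:R)^-1 *: (fun s : R => s - a) ^+ m.+1.
suff D : is_derive t 1 g ((t - a) ^+ m / m`!%:R).
  have -> // : (fun s => (s - a) ^+ m.+1 / m.+1`!%:R) = g.
  by apply/funext => s; rewrite mulrC /g; congr (_ * _); rewrite fctE.
rewrite /g; apply: is_derive_eq; rewrite /GRing.scale /= subr0 factS natrM.
have : m.+1%:R != 0 :> R by rewrite pnatr_eq0.
have : m`!%:R != 0 :> R by rewrite pnatr_eq0 -lt0n fact_gt0.
by move=> m0 m1; rewrite mulr1; field; rewrite m0 addrC natr1.
Qed.

(** Induction on [M]: the error of order [M.+1] vanishes at [a] and its derivative is the error of
    order [M] for the shifted chain, so [deriv_on_le] compares it with a primitive of the bound.
    Taking an explicit chain of derivatives lets the kernel be expanded in y, where each derivative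
    changes two indices at once. *)
Lemma taylor_le f a d C M :
  (forall n z, `|z - a| <= d -> is_derive z 1 (f n) (f n.+1 z)) ->
  (forall z, `|z - a| <= d -> `|f M z| <= C) ->
  forall z, `|z - a| <= d ->
  `|f 0 z - \sum_(m < M) (z - a) ^+ m / m`!%:R * f m a|
    <= C * (`|z - a| ^+ M / M`!%:R).
Proof.
elim: M f => [|M IH] f Df fC z zd.
  by rewrite big_ord0 subr0 expr0 divr1 mulr1 fC.
have {}IH := IH (fun n => f n.+1) (fun n => Df n.+1) fC.
pose g t := f 0 t - \sum_(m < M.+1) (t - a) ^+ m / m`!%:R * f m a.
pose dg t := f 1%N t - \sum_(m < M) (t - a) ^+ m / m`!%:R * f m.+1 a.
have ga : g a = 0.
  rewrite /g big_ord_recl /= big1 ?addr0; last first.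
    by move=> i _; rewrite subrr expr0n /= !mul0r.
  by rewrite expr0 divr1 mul1r subrr.
have Dg x y : (forall t, t \in `[x, y] -> `|t - a| <= d) -> deriv_on x y g dg.
  move=> xyd.
  have D0 : deriv_on x y (f 0%N) (f 1%N).
    by apply: deriv_on_full => t /xyd; exact: Df.
  have D1 : deriv_on x y
      (fun t => \sum_(m < M) (t - a) ^+ m.+1 / m.+1`!%:R * f m.+1 a)
      (fun t => \sum_(m < M) (t - a) ^+ m / m`!%:R * f m.+1 a).
    apply: deriv_on_sum => m.
    apply: deriv_on_eq (deriv_onZ (f m.+1 a) (deriv_on_full
      (fun t (_ : t \in `[x, y]) => is_derive_powfact a t m))).
      by move=> t; rewrite mulrC.
    by move=> t _; rewrite mulrC.
  apply: deriv_on_eq (deriv_onB D0 (deriv_onD (deriv_on_cst x y (f 0%N a)) D1)).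
    move=> t; rewrite /g big_ord_recl /= expr0 divr1 mul1r; by congr (_ - (_ + _)).
  by move=> t _; rewrite add0r.
rewrite -/(g z).
have [az|za] := leP a z.
- have zd' t : t \in `[a, z] -> `|t - a| <= d.
    rewrite in_itv/= => /andP[ta tz]; apply: le_trans zd.
    by rewrite !ger0_norm ?subr_ge0// lerB.
  have Dphi := deriv_onZ C (deriv_on_full
    (fun t (_ : t \in `[a, z]) => is_derive_powfact a t M)).
  have := deriv_on_le az (Dg _ _ zd') Dphi.
  rewrite ga subr0 subrr expr0n /= mul0r mulr0 subr0.
  rewrite (ger0_norm (_ : 0 <= z - a)) ?subr_ge0//; apply=> t tz; have ta : a <= t by move: tz; rewrite in_itv/= => /andP[/ltW].
  have := IH t (zd' t (subset_itv_oo_cc tz)).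
  by rewrite (ger0_norm (_ : 0 <= t - a)) ?subr_ge0.
- have zd' t : t \in `[z, a] -> `|t - a| <= d.
    rewrite in_itv/= => /andP[zt ta]; apply: le_trans zd.
    by rewrite !ler0_norm; lra.
  (* To the left of [a] the sign (-1)^M turns |t - a|^M into a polynomial, so the same primitive
     serves again. *)
  have s : (-1 : R) ^+ M * (-1) ^+ M = 1 by rewrite -exprMn mulrNN mulr1 expr1n.
  have sg (t : R) : t <= a -> `|t - a| ^+ M = (-1) ^+ M * (t - a) ^+ M.
    by move=> ta; rewrite ler0_norm ?subr_le0// -exprMn mulN1r.
  have Dphi := deriv_onZ (C * (-1) ^+ M) (deriv_on_full
    (fun t (_ : t \in `[z, a]) => is_derive_powfact a t M)).
  have := deriv_on_le (ltW za) (Dg _ _ zd') Dphi.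
  rewrite ga sub0r normrN subrr expr0n /= mul0r mulr0 sub0r.
  have -> : - (C * (-1) ^+ M * ((z - a) ^+ M.+1 / M.+1`!%:R)) =
      C * (`|z - a| ^+ M.+1 / M.+1`!%:R).
    rewrite [`|z - a| ^+ _]exprS (sg _ (ltW za)) ler0_norm ?subr_le0 ?ltW//.
    by rewrite [(z - a) ^+ M.+1]exprS; ring.
  apply=> t tz; have ta : t <= a by move: tz; rewrite in_itv/= => /andP[_ /ltW].
  have := IH t (zd' t (subset_itv_oo_cc tz)); rewrite sg//.
  by rewrite -!mulrA.
Qed.

End taylor.

Section Int01.
Context {R : realType}.
Implicit Types (f F : R -> R).

Definition Int01 f : R := (\int[lebesgue_measure]_(t in `[0%R, 1%R]) f t)%R.

(** All later facts about [Int01] pass through such a primitive, so that integral estimates become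
    comparisons by [deriv_on_le]. *)
Lemma Int01_primitive f : {within `[0, 1], continuous f} ->
  exists2 F, deriv_on 0 1 F f & F 1 - F 0 = Int01 f.
Proof.
move=> cf.
have fi : (@lebesgue_measure R).-integrable `[0, 1] (EFin \o f).
  by apply: continuous_compact_integrable => //; exact: segment_compact.
exists (fun x => parameterized_integral lebesgue_measure 0 x f); last first.
  by rewrite /parameterized_integral set_itv1 Rintegral_set1 subr0.
split; first exact: parameterized_integral_continuous.
move=> t t01.
have cft : {for t, continuous f}.
  by have /(continuous_within_itvP _ ltr01)[cf' _ _] := cf; exact: cf'.
move: t01; rewrite in_itv/= => /andP[t0 t1].
have [dF F'] := continuous_FTC1_closed t1 fi t0 cft.
by rewrite -[f t]F' derive1E; exact/derivableP.
Qed.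

Lemma Int01E f F : {within `[0, 1], continuous f} -> deriv_on 0 1 F f ->
  Int01 f = F 1 - F 0.
Proof.
move=> cf DF; have [G DG <-] := Int01_primitive cf.
have := deriv_on_le ler01 (deriv_onB DG DF) (deriv_on_cst 0 1 0).
rewrite subrr normr_le0 => H; apply/eqP; rewrite -subr_eq0.
have -> : G 1 - G 0 - (F 1 - F 0) = G 1 - F 1 - (G 0 - F 0) by ring.
by apply: H => t _; rewrite subrr normr0.
Qed.

Lemma Int01_le f (K : R) : {within `[0, 1], continuous f} ->
  (forall t, t \in `[0, 1] -> `|f t| <= K) -> `|Int01 f| <= K.
Proof.
move=> cf fK; have [F DF <-] := Int01_primitive cf.
have DK : deriv_on 0 1 (fun t : R => K * t) (fun=> K * 1).
  by apply/deriv_onZ/deriv_on_full => t _; exact: is_derive_id.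
have := deriv_on_le ler01 DF DK; rewrite mulr1 mulr0 subr0; apply => t t01.
by rewrite fK//; exact: subset_itv_oo_cc.
Qed.

Lemma Int01_lin (M : nat) f (g : 'I_M -> R -> R) (c : 'I_M -> R) :
  {within `[0, 1], continuous f} ->
  (forall m, {within `[0, 1], continuous (g m)}) ->
  {within `[0, 1], continuous (fun t => f t - \sum_(m < M) c m * g m t)} /\
  Int01 (fun t => f t - \sum_(m < M) c m * g m t) =
    Int01 f - \sum_(m < M) c m * Int01 (g m).
Proof.
move=> cf cg.
have ch : {within `[0, 1], continuous (fun t => f t - \sum_(m < M) c m * g m t)}.
  apply: within_continuousD => //; apply: within_continuousN.
  apply: within_continuous_sum => m; apply: within_continuousM => //.
  exact: within_continuous_cst.
split=> //.
have [F DF <-] := Int01_primitive cf.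
have /choice[G DG] : forall m, exists G, deriv_on 0 1 G (g m).
  by move=> m; have [G DG _] := Int01_primitive (cg m); exists G.
have DH := deriv_onB DF (deriv_on_sum (index_enum 'I_M)
  (fun m => deriv_onZ (c m) (DG m))).
rewrite (Int01E ch DH).
under [in RHS]eq_bigr do rewrite (Int01E (cg _) (DG _)) mulrBr.
by rewrite sumrB; ring.
Qed.

End Int01.

(** * The operators Q_k(d/dt) and the Poisson kernel *)

Section jets.
Context {R : realType}.
Implicit Types (a b : nat -> R).

(* [jetF k] is the differential operator Q_k(d/dt), Q_0 = 0, Q_1 = 1,
   Q_(k+2) = X Q_(k+1) + Q_k, acting on the sequence of derivatives of a
   function: f_k = Q_k(d/dt) phi solves f_k' = f_(k+1) - f_(k-1), f_0 = 0. *)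
Fixpoint jetF (k : nat) (a : nat -> R) : R :=
  if k isn't k1.+1 then 0
  else if k1 isn't k2.+1 then a 0%N
  else jetF k1 (fun j => a j.+1) + jetF k2 a.

Lemma jetFSS k a : jetF k.+2 a = jetF k.+1 (fun j => a j.+1) + jetF k a.
Proof. by []. Qed.

Lemma jetF_ind2 (P : nat -> Prop) : P 0%N -> P 1%N ->
  (forall k, P k -> P k.+1 -> P k.+2) -> forall k, P k.
Proof.
move=> P0 P1 PSS k; suff [] : P k /\ P k.+1 by [].
by elim: k => // k [Pk Pk1]; split=> //; exact: PSS.
Qed.

Lemma eq_jetF k a b : (forall j, a j = b j) -> jetF k a = jetF k b.
Proof. by move=> /funext ->. Qed.

Lemma jetFB k a b : jetF k (fun j => a j - b j) = jetF k a - jetF k b.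
Proof.
elim/jetF_ind2: k a b => [||k IH0 IH1] a b; rewrite ?subrr//.
by rewrite !jetFSS IH0 IH1 opprD addrACA.
Qed.

Lemma jetFZ k (c : R) a : jetF k (fun j => c * a j) = c * jetF k a.
Proof.
elim/jetF_ind2: k a => [||k IH0 IH1] a; rewrite ?mulr0//.
by rewrite !jetFSS IH0 IH1 mulrDr.
Qed.

Lemma jetF_sum k (I : Type) (s : seq I) (a : I -> nat -> R) :
  jetF k (fun j => \sum_(i <- s) a i j) = \sum_(i <- s) jetF k (a i).
Proof.
elim/jetF_ind2: k a => [||k IH0 IH1] a.
- by rewrite big1.
- by [].
- by rewrite jetFSS IH0 IH1 -big_split.
Qed.

Lemma deriv_on_jetF k (x y : R) (phi : nat -> R -> R) :
  (forall j, deriv_on x y (phi j) (phi j.+1)) ->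
  deriv_on x y (fun t => jetF k (fun j => phi j t))
               (fun t => jetF k (fun j => phi j.+1 t)).
Proof.
elim/jetF_ind2: k phi => [||k IH0 IH1] phi Dphi.
- exact: deriv_on_cst.
- exact: Dphi.
- by apply: deriv_onD; [apply: IH1|apply: IH0] => j; exact: Dphi.
Qed.

(** A majorant, common to all r <= c, of the product of the factors 1 + r^2/(k (k + 1)). The 3
    absorbs (i + 3)/(i + 1) <= 3 when the factors are compared with a telescoping exponent. *)
Definition jetE (c : R) : R := expR (3 * c ^+ 2).

Lemma jetE_ge1 (c : R) : 1 <= jetE c.
Proof. by rewrite /jetE -expR0 ler_expR mulr_ge0// sqr_ge0. Qed.

(* Each step of the recursion costs a factor 1 + r^2 / (k (k + 1)), and the
   product of these factors converges: it is dominated by G. *)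
Lemma jetF_bound (c K r : R) a k : 0 < r -> r <= c -> 0 <= K ->
  (forall j, `|a j| <= K * (j`!%:R / r ^+ j)) ->
  `|jetF k.+1 a| <= K * jetE c * (k`!%:R / r ^+ k).
Proof.
move=> r_gt0 rc K_ge0 aK.
pose G k : R := expR (3 * c ^+ 2 * (1 - k.+1%:R^-1)).
have c3 : 0 <= 3 * c ^+ 2 by apply: mulr_ge0 => //; exact: sqr_ge0.
have G_ge0 i : 0 <= G i by exact: expR_ge0.
have G_ge1 i : 1 <= G i.
  rewrite /G -[leLHS]expR0 ler_expR mulr_ge0//.
  by rewrite subr_ge0 invf_le1 ?ler1n.
have w_ge0 i : 0 <= i`!%:R / r ^+ i by rewrite divr_ge0// exprn_ge0// ltW.
have GS i : G i.+1 + G i * (r ^+ 2 / (i.+2%:R * i.+1%:R)) <= G i.+2.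
  have r2 : r ^+ 2 <= c ^+ 2.
    by rewrite lerXn2r// nnegrE ltW// (lt_le_trans r_gt0).
  have -> : G i.+2 = G i.+1 * expR (3 * c ^+ 2 / (i.+2%:R * i.+3%:R)).
    rewrite /G -expRD; congr expR.
    have i2 : i.+2%:R != 0 :> R by rewrite pnatr_eq0.
    have i3 : i.+3%:R = i.+2%:R + 1 :> R by rewrite natr1.
    have i4 : i.+2%:R + 1 != 0 :> R by rewrite -i3 pnatr_eq0.
    rewrite i3; move: (i.+2%:R : R) i2 i4 => x x0 x1.
    by field; rewrite x0 x1.
  apply: (@le_trans _ _ (G i.+1 * (1 + r ^+ 2 / (i.+2%:R * i.+1%:R)))).
    rewrite mulrDr mulr1 lerD2l; apply: ler_wpM2r.
      by rewrite divr_ge0// ?sqr_ge0// mulr_ge0.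
    rewrite ler_expR ler_wpM2l // lerB// lef_pV2 ?posrE//.
    by rewrite ler_nat.
  apply: ler_wpM2l => //; apply: le_trans (expR_ge1Dx _); rewrite lerD2l.
  apply: (@le_trans _ _ (c ^+ 2 / (i.+2%:R * i.+1%:R))).
    by rewrite ler_wpM2r// invr_ge0 mulr_ge0.
  rewrite [leRHS]mulrAC [leRHS]mulrC; apply: ler_wpM2l; first exact: sqr_ge0.
  have -> : 3 / (i.+2%:R * i.+3%:R) = (i.+2%:R * (i.+3%:R / 3))^-1 :> R.
    by rewrite [in LHS]invfM [in RHS]invfM invf_div mulrCA.
  rewrite lef_pV2 ?posrE ?mulr_gt0 ?invr_gt0// ler_wpM2l// ler_pdivrMr//.
  by rewrite -natrM ler_nat; lia.
(* The recursion shifts the sequence, so the induction carries all shifts at once; a shift by [i]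
   counts as [i] more derivatives. *)
suff H i : `|jetF k.+1 (fun j => a (i + j)%N)| <=
    K * G k * ((k + i)`!%:R / r ^+ (k + i)).
  have := H 0%N; rewrite addn0 => /le_trans; apply.
  rewrite ler_wpM2r// ler_wpM2l// ler_expR ler_piMr//.
elim/jetF_ind2: k i => [||k IH0 IH1] i.
- rewrite /= addn0 add0n (le_trans (aK _))// ler_wpM2r//.
  by rewrite ler_peMr.
- rewrite /= addr0 addn1 add1n (le_trans (aK _))// ler_wpM2r//.
  by rewrite ler_peMr.
- rewrite jetFSS (le_trans (ler_normD _ _))//.
  rewrite (@eq_jetF _ _ (fun j => a (i.+1 + j)%N)); last first.
    by move=> j; rewrite addSnnS.
  apply: le_trans (lerD (IH1 i.+1) (IH0 i)) _.
  have -> : (k.+1 + i.+1 = (k + i).+2)%N by lia.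
  rewrite !addSn.
  have r_neq0 : r != 0 by rewrite gt_eqF.
  have ki1 : (k + i).+1%:R != 0 :> R by rewrite pnatr_eq0.
  have ki2 : (k + i).+2%:R != 0 :> R by rewrite pnatr_eq0.
  have E : (k + i)`!%:R / r ^+ (k + i) =
      (k + i).+2`!%:R / r ^+ (k + i).+2 *
        (r ^+ 2 / ((k + i).+2%:R * (k + i).+1%:R)) :> R.
    rewrite !factS !natrM !exprS expr0 mulr1.
    rewrite -[RHS]mulrA; move: ki1 ki2 (expf_neq0 (k + i) r_neq0).
    move: ((k + i).+1%:R : R) ((k + i).+2%:R : R) => x y x0 y0 z0.
    by field; rewrite x0 y0 z0 r_neq0.
  rewrite E; move: (w_ge0 (k + i).+2).
  set w := _`!%:R / _; set q := r ^+ 2 / _ => w0.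
  have -> : K * G k.+1 * w + K * G k * (w * q) = K * w * (G k.+1 + G k * q).
    by ring.
  rewrite [leRHS]mulrAC ler_wpM2l// ?(mulr_ge0 K_ge0 w0)// (le_trans _ (GS k))// lerD2l.
  rewrite ler_wpM2l// ler_wpM2l ?sqr_ge0// lef_pV2 ?posrE ?mulr_gt0//.
  by rewrite -!natrM ler_nat leq_mul// !ltnS leq_addr.
Qed.

End jets.

(** * Derivatives of 1/(s - x - iy) in real coordinates *)

Section kernel.
Context {R : realType}.
Implicit Types (a b s t x y r : R) (n m th : nat).

(* [pw n a b] is (a + i b)^(n+1) and [imi th a b] is Im (i^th (a + i b)). *)
Fixpoint pw n a b : R * R :=
  if n is n1.+1 then
    ((pw n1 a b).1 * a - (pw n1 a b).2 * b, (pw n1 a b).1 * b + (pw n1 a b).2 * a)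
  else (a, b).

Fixpoint imi th a b : R := if th is th1.+1 then imi th1 (- b) a else b.

Lemma imiN th a b : imi th (- a) (- b) = - imi th a b.
Proof. by elim: th a b => //= th IH a b; rewrite -IH opprK. Qed.

Lemma imiZ th c a b : imi th (c * a) (c * b) = c * imi th a b.
Proof. by elim: th a b => //= th IH a b; rewrite -IH mulrN. Qed.

Lemma imi_le th a b c : `|a| <= c -> `|b| <= c -> `|imi th a b| <= c.
Proof. by elim: th a b => //= th IH a b ac bc; rewrite IH// normrN. Qed.

Lemma is_derive_imi th (f g : R -> R) t df dg :
  is_derive t 1 f df -> is_derive t 1 g dg ->
  is_derive t 1 (fun u => imi th (f u) (g u)) (imi th df dg).
Proof.
elim: th f g df dg => //= th IH f g df dg Df Dg.
by apply: (IH (fun u => - g u)) => //; exact: is_deriveN.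
Qed.

Lemma pw_norm n a b :
  (pw n a b).1 ^+ 2 + (pw n a b).2 ^+ 2 = (a ^+ 2 + b ^+ 2) ^+ n.+1.
Proof.
elim: n => [|n IH]; first by rewrite expr1.
by rewrite [RHS]exprS -IH /=; ring.
Qed.

(* If p' = g p^2 along a curve, then (p^(n+1))' = (n+1) g p^(n+2). *)
Lemma is_derive_pw n (f g : R -> R) t g1 g2 :
  let A k := (pw k (f t) (g t)).1 in let B k := (pw k (f t) (g t)).2 in
  is_derive t 1 f (g1 * A 1%N - g2 * B 1%N) ->
  is_derive t 1 g (g1 * B 1%N + g2 * A 1%N) ->
  is_derive t 1 (fun u => (pw n (f u) (g u)).1)
    (n.+1%:R * (g1 * A n.+1 - g2 * B n.+1)) /\
  is_derive t 1 (fun u => (pw n (f u) (g u)).2)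
    (n.+1%:R * (g1 * B n.+1 + g2 * A n.+1)).
Proof.
move=> A B Df Dg; elim: n => [|n [DA DB]]; first by rewrite !mul1r.
have E1 : A 1%N = f t * f t - g t * g t by [].
have E2 : B 1%N = f t * g t + g t * f t by [].
have E3 : A n.+1 = A n * f t - B n * g t by [].
have E4 : B n.+1 = A n * g t + B n * f t by [].
have E5 : A n.+2 = A n.+1 * f t - B n.+1 * g t by [].
have E6 : B n.+2 = A n.+1 * g t + B n.+1 * f t by [].
split=> /=; apply: is_derive_eq; rewrite /GRing.scale /=;
  rewrite -/(A n) -/(B n) -/(A n.+1) -/(B n.+1) -?(natr1 n.+1) -?(natr1 n);
  rewrite E5 E6 E1 E2 E3 E4; ring.
Qed.

Definition kre x s y := (s - x) / ((s - x) ^+ 2 + y ^+ 2).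
Definition kim x s y := y / ((s - x) ^+ 2 + y ^+ 2).

(* Im (i^th (d/ds)^n (1 / (s - x - i y))); th = 0, n = 0 is the Poisson
   kernel. *)
Definition ker x n th s y : R :=
  (-1) ^+ n * n`!%:R * imi th (pw n (kre x s y) (kim x s y)).1
                              (pw n (kre x s y) (kim x s y)).2.

Let den_neq0 x s y : 0 < (s - x) ^+ 2 + y ^+ 2 -> (s - x) ^+ 2 + y ^+ 2 != 0.
Proof. by move=> /gt_eqF ->. Qed.

Let is_derive_den_s x s y :
  is_derive s 1 (fun u => (u - x) ^+ 2 + y ^+ 2) (2 * (s - x)).
Proof.
apply: is_derive_eq; rewrite /GRing.scale /= subr0; ring.
Qed.

Let is_derive_den_y x s y :
  is_derive y 1 (fun u => (s - x) ^+ 2 + u ^+ 2) (2 * y).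
Proof.
apply: is_derive_eq; rewrite /GRing.scale /=; ring.
Qed.

Lemma is_derive_ker_s x n th s y : 0 < (s - x) ^+ 2 + y ^+ 2 ->
  is_derive s 1 (fun u => ker x n th u y) (ker x n.+1 th s y).
Proof.
move=> /den_neq0 d0.
have DV := @is_deriveV _ (fun u => (u - x) ^+ 2 + y ^+ 2) s _ 1 d0
  (is_derive_den_s x s y).
set A := fun n => (pw n (kre x s y) (kim x s y)).1.
set B := fun n => (pw n (kre x s y) (kim x s y)).2.
have D1 : is_derive s 1 (fun u => kre x u y) (-1 * A 1%N - 0 * B 1%N).
  by apply: is_derive_eq; rewrite /GRing.scale /A /B /= /kre /kim subr0; field.
have D2 : is_derive s 1 (fun u => kim x u y) (-1 * B 1%N + 0 * A 1%N).
  by apply: is_derive_eq; rewrite /GRing.scale /A /B /= /kre /kim; field.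
have [DA DB] := is_derive_pw n D1 D2.
have DI := is_deriveZ ((-1) ^+ n * n`!%:R) (is_derive_imi th DA DB).
suff -> : ker x n.+1 th s y = (-1) ^+ n * n`!%:R *:
  imi th (n.+1%:R * (-1 * A n.+1 - 0 * B n.+1))
         (n.+1%:R * (-1 * B n.+1 + 0 * A n.+1)) by [].
rewrite !mul0r subr0 addr0 !mulN1r !mulrN imiN imiZ /GRing.scale /= /ker.
by rewrite exprS factS natrM -/(A n.+1) -/(B n.+1); ring.
Qed.

(** By holomorphy d/dy acts on 1/(s - x - iy) as -i d/ds, and -i = i^3 is the shift of [th] by 3. *)
Lemma is_derive_ker_y x n th s y : 0 < (s - x) ^+ 2 + y ^+ 2 ->
  is_derive y 1 (fun u => ker x n th s u) (ker x n.+1 (th + 3) s y).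
Proof.
move=> /den_neq0 d0.
have DV := @is_deriveV _ (fun u => (s - x) ^+ 2 + u ^+ 2) y _ 1 d0
  (is_derive_den_y x s y).
set A := fun n => (pw n (kre x s y) (kim x s y)).1.
set B := fun n => (pw n (kre x s y) (kim x s y)).2.
have D1 : is_derive y 1 (fun u => kre x s u) (0 * A 1%N - 1 * B 1%N).
  by apply: is_derive_eq; rewrite /GRing.scale /A /B /= /kre /kim; field.
have D2 : is_derive y 1 (fun u => kim x s u) (0 * B 1%N + 1 * A 1%N).
  by apply: is_derive_eq; rewrite /GRing.scale /A /B /= /kre /kim; field.
have [DA DB] := is_derive_pw n D1 D2.
have DI := is_deriveZ ((-1) ^+ n * n`!%:R) (is_derive_imi th DA DB).
suff -> : ker x n.+1 (th + 3) s y = (-1) ^+ n * n`!%:R *: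
  imi th (n.+1%:R * (0 * A n.+1 - 1 * B n.+1))
         (n.+1%:R * (0 * B n.+1 + 1 * A n.+1)) by [].
rewrite !mul0r sub0r add0r !mul1r imiZ /GRing.scale /= /ker addn3 /=.
have E : imi th (- - B n.+1) (- A n.+1) = - imi th (- B n.+1) (A n.+1).
  exact: imiN.
rewrite -/(A n.+1) -/(B n.+1) E exprS factS natrM.
by ring.
Qed.

Lemma ker_le x n th s y r : 0 < r -> r ^+ 2 <= (s - x) ^+ 2 + y ^+ 2 ->
  `|ker x n th s y| <= n`!%:R / r ^+ n.+1.
Proof.
move=> r0 rd; have d0 : 0 < (s - x) ^+ 2 + y ^+ 2.
  by apply: lt_le_trans rd; rewrite exprn_gt0.
have E : kre x s y ^+ 2 + kim x s y ^+ 2 = ((s - x) ^+ 2 + y ^+ 2)^-1.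
  rewrite /kre /kim; move: (den_neq0 d0); set d := _ + _ => d1.
  by rewrite !expr_div_n -mulrDl -/d expr2 invfM mulrA divff// mul1r.
have H : (pw n (kre x s y) (kim x s y)).1 ^+ 2 +
         (pw n (kre x s y) (kim x s y)).2 ^+ 2 <= (r ^- n.+1) ^+ 2.
  rewrite pw_norm E !exprVn -exprM mulnC exprM.
  rewrite lef_pV2 ?posrE ?exprn_gt0// lerXn2r// nnegrE ?sqr_ge0//.
  exact: ltW.
have r1 : 0 <= r ^- n.+1 by rewrite invr_ge0 exprn_ge0// ltW.
rewrite /ker !normrM normrX normrN1 expr1n mul1r ger0_norm//.
rewrite ler_wpM2l// imi_le// -(ler_pXn2r (n := 2))// ?nnegrE// real_normK ?num_real//.
- by apply: le_trans H; rewrite lerDl sqr_ge0.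
- by apply: le_trans H; rewrite lerDr sqr_ge0.
Qed.

End kernel.

(** * The half-line equation *)

(** One term of the binomial expansion is at most the whole sum. The lemma splits a radius of
    analyticity: a bound on derivatives of order m + n with radius u + v becomes a jet bound in m
    with radius u, the part v being spent on the n other derivatives. *)
Lemma fact_exp_binom (R : realType) (u v : R) (m n : nat) : 0 < u -> 0 < v ->
  (m + n)`!%:R / (u + v) ^+ (m + n) <= m`!%:R / u ^+ m * (n`!%:R / v ^+ n).
Proof.
move=> u0 v0; have uv0 : 0 < u + v by exact: addr_gt0.
have H : 'C(m + n, n)%:R * (u ^+ m * v ^+ n) <= (u + v) ^+ (m + n).
  have nmn : (n < (m + n).+1)%N by rewrite ltnS leq_addl.
  rewrite exprDn (bigD1 (Ordinal nmn))//= addnK mulr_natl lerDl.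
  by apply: sumr_ge0 => i _; rewrite mulrn_wge0// mulr_ge0// exprn_ge0// ltW.
have um : 0 < u ^+ m by rewrite exprn_gt0.
have vn : 0 < v ^+ n by rewrite exprn_gt0.
rewrite mulrACA -invfM ler_pdivrMr ?exprn_gt0//.
rewrite -[leRHS]mulrA [X in _ <= _ * X]mulrC mulrA ler_pdivlMr ?mulr_gt0//.
have -> : (m + n)`!%:R = m`!%:R * n`!%:R * 'C(m + n, n)%:R :> R.
  rewrite -!natrM -(bin_fact (leq_addl m n)) addnK (mulnC n`!).
  by rewrite mulnC.
rewrite -[leLHS]mulrA; apply: ler_wpM2l => //; exact: mulr_ge0.
Qed.

Lemma geometric_sum_le (R : realType) (z : R) N : 0 <= z -> z < 1 ->
  \sum_(k < N) z ^+ k <= (1 - z)^-1.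
Proof.
move=> z0 z1; have z1' : 0 < 1 - z by rewrite subr_gt0.
rewrite -[leRHS]mul1r ler_pdivlMr// mulrC.
have -> : (1 - z) * (\sum_(k < N) z ^+ k) = 1 - z ^+ N.
  by have := subrX1 z N; lra.
by rewrite gerBl exprn_ge0.
Qed.

Section half_line.
Context {R : realType} (q : nat -> R -> R) (B rho : R).
Hypothesis rho_gt0 : 0 < rho.
Hypothesis rho_lt1 : rho < 1.
Hypothesis cq0 : {within `[0, 1], continuous (q 0)}.
Hypothesis Dq : forall k, deriv_on 0 1 (q k.+1) (fun t => q k.+2 t - q k t).
Hypothesis q_le : forall k t, t \in `[0, 1] -> `|q k t| <= B.
Hypothesis q0_le : forall k, `|q k 0| <= B * (rho ^+ k / k`!%:R).
Hypothesis q1_le : forall k, `|q k 1| <= B * (rho ^+ k / k`!%:R).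

Let B_ge0 : 0 <= B.
Proof.
apply: le_trans (normr_ge0 _) (q_le 0 (_ : 0 \in `[0, 1])).
by rewrite in_itv/= lexx ler01.
Qed.

(** Reaching the boundary from site k takes k steps of the equation, so the uniform bound can be
    integrated k times, each time with a factor 2 for the two neighbours. Of the data, only those at
    t = 0 enter. *)
Lemma half_line_growth k t : t \in `[0, 1] -> `|q k t| <= B * (3 ^+ k / k`!%:R).
Proof.
(* With this origin 2 (0 - a) = 1, so the majorant equals B/j! at time 0 and absorbs the initial
   value; at time 1 one has 2 (1 - a) = 3, the base in the statement. *)
pose a : R := - 2^-1.
have t01 s : s \in `[0, 1] -> 0 <= s - a <= 3 / 2.
  by rewrite in_itv/= /a => /andP[? ?]; apply/andP; split; lra.
suff H j : forall k s, (j <= k)%N -> s \in `[0, 1] ->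
    `|q k s| <= B * 2 ^+ j * ((s - a) ^+ j / j`!%:R).
  move=> tI; apply: le_trans (H k k t (leqnn k) tI) _.
  have /andP[ta0 ta1] := t01 _ tI.
  rewrite -mulrA ler_wpM2l// mulrA -exprMn ler_wpM2r//.
  by rewrite lerXn2r// ?nnegrE; lra.
elim: j => {t k}[|j IH] k s jk sI.
  by rewrite !expr0 divr1 !mulr1 q_le.
case: k jk => // k; rewrite ltnS => jk.
move: (sI); rewrite in_itv/= => /andP[s0 s1].
have D1 := deriv_onS (lexx 0) s1 (Dq k).
have D2 := deriv_onZ (B * 2 ^+ j.+1) (deriv_on_full
  (fun t (_ : t \in `[0, s]) => is_derive_powfact a t j)).
have H : `|q k.+1 s - q k.+1 0| <=
    B * 2 ^+ j.+1 * ((s - a) ^+ j.+1 / j.+1`!%:R) -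
    B * 2 ^+ j.+1 * ((0 - a) ^+ j.+1 / j.+1`!%:R).
  apply: deriv_on_le s0 D1 D2 _ => t ts.
  have tI : t \in `[0, 1].
    move: ts; rewrite !in_itv/= => /andP[t0 t1].
    by rewrite (ltW t0) (le_trans (ltW t1)).
  apply: le_trans (ler_normB _ _) _.
  apply: le_trans (lerD (IH k.+2 t _ tI) (IH k t jk tI)) _; first by lia.
  by rewrite exprS; lra.
have E : B * 2 ^+ j.+1 * ((0 - a) ^+ j.+1 / j.+1`!%:R) = B / j.+1`!%:R.
  by rewrite mulrA -[B * _ * _]mulrA -exprMn /a sub0r opprK divff// expr1n mulr1.
have q0' : `|q k.+1 0| <= B / j.+1`!%:R.
  apply: le_trans (q0_le _) _; rewrite ler_wpM2l// -[leRHS]mul1r.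
  apply: ler_pM => //; first by rewrite exprn_ge0// ltW.
    by rewrite exprn_ile1// ltW.
  by rewrite lef_pV2 ?posrE ?ltr0n ?fact_gt0// ler_nat leq_fact.
have := ler_normD (q k.+1 s - q k.+1 0) (q k.+1 0); rewrite subrK => H'.
rewrite E in H; lra.
Qed.

Definition bdry N (phi : nat -> R -> R) : R :=
  \sum_(k < N) (q k.+1 1 * jetF k.+1 (fun j => phi j 1) -
                q k.+1 0 * jetF k.+1 (fun j => phi j 0)).

(* For a jet [phi] this is the integral over [0, 1] of
   q_(N+1) f_N + q_N f_(N+1), where f_k = Q_k(d/dt) phi. *)
Definition Lam N (phi : nat -> R -> R) : R :=
  bdry N phi + Int01 (fun t => q 0 t * phi 0 t).

(** Telescoping leaves two interior terms, in which the factorials of 3^k/k! and k!/12^k cancel and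
    the ratio 3/12 remains. The terms contribute at most 9 and 1/4 times 4^-N, whence the constant
    10. *)
Lemma Lam_small K phi N :
  (forall j, deriv_on 0 1 (phi j) (phi j.+1)) ->
  (forall j t, t \in `[0, 1] -> `|phi j t| <= K * (j`!%:R / 12 ^+ j)) ->
  `|Lam N.+1 phi| <= 10 * B * K * jetE 12 * 4^-1 ^+ N.
Proof.
move=> Dphi phiK.
have K_ge0 : 0 <= K.
  have : (0 : R) \in `[0, 1] by rewrite in_itv/= lexx ler01.
  by move=> /(phiK 0)/(le_trans (normr_ge0 _)); rewrite divr1 mulr1.
have cI : {within `[0, 1], continuous (fun t => q 0 t * phi 0 t)}.
  by apply: within_continuousM => //; have [] := Dphi 0%N.
have [F DF F01] := Int01_primitive cI.
have DT := deriv_onD (deriv_on_sum (index_enum 'I_N.+1) (fun k : 'I_N.+1 =>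
  deriv_onM (Dq k) (deriv_on_jetF k.+1 Dphi))) DF.
have D0 : deriv_on 0 1 (fun t : R => 10 * B * K * jetE 12 * 4^-1 ^+ N * t)
    (fun=> 10 * B * K * jetE 12 * 4^-1 ^+ N * 1).
  by apply/deriv_onZ/deriv_on_full => t _; exact: is_derive_id.
have := deriv_on_le ler01 DT D0.
rewrite mulr1 mulr0 subr0 => H.
have -> : Lam N.+1 phi =
    \sum_(k < N.+1) q k.+1 1 * jetF k.+1 (fun j => phi j 1) + F 1 -
    (\sum_(k < N.+1) q k.+1 0 * jetF k.+1 (fun j => phi j 0) + F 0).
  by rewrite /Lam /bdry sumrB -F01; ring.
apply: H => t /subset_itv_oo_cc t01.
pose f k := jetF k (fun j => phi j t).
have -> : \sum_(k < N.+1) ((q k.+2 t - q k t) * jetF k.+1 (phi^~ t) +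
    q k.+1 t * jetF k.+1 (fun j => phi j.+1 t)) + q 0 t * phi 0 t =
    q N.+2 t * f N.+1 + q N.+1 t * f N.+2.
  elim: N {DT D0} => [|N IH].
    by rewrite big_ord_recr big_ord0 /= /f /=; ring.
  rewrite big_ord_recr /= addrAC IH /f !jetFSS /=; ring.
have fle k : `|f k.+1| <= K * jetE 12 * (k`!%:R / 12 ^+ k).
  by apply: jetF_bound => // j; exact: phiK.
have E_ge0 : 0 <= K * jetE 12 by rewrite mulr_ge0// (le_trans ler01)// jetE_ge1.
have prod k l : (k <= l)%N -> `|q l.+1 t * f k.+1| <=
    B * (K * jetE 12) * (3 ^+ l.+1 / 12 ^+ k).
  move=> kl; rewrite normrM.
  apply: le_trans (ler_pM _ _ (half_line_growth l.+1 t01) (fle k)) _ => //.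
  rewrite mulrACA ler_wpM2l ?(mulr_ge0 B_ge0 E_ge0)// mulrA ler_wpM2r ?invr_ge0 ?exprn_ge0//.
  rewrite -mulrA ler_piMr ?exprn_ge0// mulrC ler_pdivrMr ?ltr0n ?fact_gt0//.
  by rewrite mul1r ler_nat leq_fact// (leq_trans kl).
apply: le_trans (ler_normD _ _) _.
have prod' : `|q N.+1 t * f N.+2| <=
    B * (3 ^+ N.+1 / N.+1`!%:R) * (K * jetE 12 * (N.+1`!%:R / 12 ^+ N.+1)).
  by rewrite normrM; apply: ler_pM => //; exact: half_line_growth.
apply: le_trans (lerD (prod N N.+1 (leqnSn N)) prod') _.
have -> : B * (3 ^+ N.+1 / N.+1`!%:R) * (K * jetE 12 * (N.+1`!%:R / 12 ^+ N.+1)) =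
    B * (K * jetE 12) * (3 ^+ N.+1 / 12 ^+ N.+1).
  have : N.+1`!%:R != 0 :> R by rewrite pnatr_eq0 -lt0n fact_gt0.
  have : 12 ^+ N.+1 != 0 :> R by rewrite expf_neq0.
  move: (12 ^+ N.+1 : R) (N.+1`!%:R : R) => x y x0 y0.
  by field; rewrite x0 y0.
have -> : 4^-1 = 3 / 12 :> R by lra.
rewrite -mulrDr [leRHS](_ : _ = B * (K * jetE 12) * (10 * (3 / 12) ^+ N)); last ring.
rewrite ler_wpM2l ?(mulr_ge0 B_ge0 E_ge0)// !exprS expr_div_n.
have : 0 <= 3 ^+ N / 12 ^+ N :> R by rewrite divr_ge0// exprn_ge0.
rewrite invfM; move: (3 ^+ N) (12 ^+ N)^-1 => x y xy0.
lra.
Qed.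

End half_line.

(** * Boundary terms: bounds uniform in the truncation, and linearity in the jet *)

Section half_line_bounds.
Context {R : realType} (q : nat -> R -> R) (B rho : R).
Hypothesis B_ge0 : 0 <= B.
Hypothesis rho_gt0 : 0 < rho.
Hypothesis rho_lt1 : rho < 1.
Hypothesis cq0 : {within `[0, 1], continuous (q 0)}.
Hypothesis q_le : forall k t, t \in `[0, 1] -> `|q k t| <= B.
Hypothesis q0_le : forall k, `|q k 0| <= B * (rho ^+ k / k`!%:R).
Hypothesis q1_le : forall k, `|q k 1| <= B * (rho ^+ k / k`!%:R).

(** The decay of the data meets the growth k!/r^k of the jet: the factorials cancel and a geometric
    series of ratio rho/r is left. [D] depends neither on [N] nor on the jet, which is constrained
    only at 0 and 1, however large it may be in between. *)
Lemma bdry_le (r : R) : rho < r -> r <= 1 -> exists2 D : R, 0 <= D &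
  forall (K : R) (phi : nat -> R -> R) N, 0 <= K ->
    (forall j, `|phi j 0| <= K * (j`!%:R / r ^+ j)) ->
    (forall j, `|phi j 1| <= K * (j`!%:R / r ^+ j)) ->
    `|bdry q N phi| <= K * D.
Proof.
move=> rhor r1; have r_gt0 : 0 < r by exact: lt_trans rhor.
have z0 : 0 <= rho / r by rewrite divr_ge0 ?ltW.
have z1 : rho / r < 1 by rewrite ltr_pdivrMr// mul1r.
have E0 : 0 <= jetE (1 : R) by rewrite (le_trans ler01)// jetE_ge1.
exists (2 * (B * jetE 1) / (1 - rho / r)).
  by rewrite divr_ge0 ?mulr_ge0// subr_ge0 ltW.
move=> K phi N K0 phi0 phi1.
have term k (x : R) (a : nat -> R) : `|x| <= B * (rho ^+ k.+1 / k.+1`!%:R) ->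
    (forall j, `|a j| <= K * (j`!%:R / r ^+ j)) ->
    `|x * jetF k.+1 a| <= K * (B * jetE 1) * (rho / r) ^+ k.
  move=> xle ale; rewrite normrM.
  apply: le_trans (ler_pM _ _ xle (jetF_bound k r_gt0 r1 K0 ale)) _ => //.
  rewrite mulrACA [B * (K * _)]mulrCA ler_wpM2l ?mulr_ge0//.
  have -> : rho ^+ k.+1 / k.+1`!%:R * (k`!%:R / r ^+ k) =
      (rho / r) ^+ k * (rho * (k`!%:R / k.+1`!%:R)).
    by rewrite exprS expr_div_n; ring.
  rewrite ler_piMr ?exprn_ge0// mulr_ile1 ?(ltW rho_gt0) ?(ltW rho_lt1)//.
  by rewrite ler_pdivrMr ?ltr0n ?fact_gt0// mul1r ler_nat leq_fact.
rewrite /bdry; apply: le_trans (ler_norm_sum _ _ _) _.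
apply: (@le_trans _ _ (\sum_(k < N) 2 * (K * (B * jetE 1)) * (rho / r) ^+ k)).
  apply: ler_sum => k _; apply: le_trans (ler_normB _ _) _.
  apply: le_trans (lerD (term _ _ _ (q1_le _) phi1) (term _ _ _ (q0_le _) phi0)) _.
  lra.
have -> : K * (2 * (B * jetE 1) / (1 - rho / r)) =
    2 * (K * (B * jetE 1)) * (1 - rho / r)^-1 by ring.
rewrite -mulr_sumr; apply: ler_wpM2l; first by rewrite !mulr_ge0.
exact: geometric_sum_le.
Qed.

Lemma Int01q_le (K : R) (f : R -> R) : 0 <= K -> {within `[0, 1], continuous f} ->
  (forall t, t \in `[0, 1] -> `|f t| <= K) ->
  `|Int01 (fun t => q 0 t * f t)| <= K * B.
Proof.
move=> K0 cf fK; apply: Int01_le; first exact: within_continuousM.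
by move=> t t01; rewrite normrM mulrC ler_pM ?fK ?q_le.
Qed.

Lemma bdry_lin N M (phi : nat -> R -> R) (psi : 'I_M -> nat -> R -> R) (c : 'I_M -> R) :
  bdry q N (fun j t => phi j t - \sum_(m < M) c m * psi m j t) =
  bdry q N phi - \sum_(m < M) c m * bdry q N (psi m).
Proof.
rewrite /bdry.
under [X in _ = _ - X]eq_bigr do rewrite mulr_sumr.
rewrite exchange_big -sumrB; apply: eq_bigr => k _; cbv beta.
have E s : jetF k.+1 (fun j => phi j s - \sum_(m < M) c m * psi m j s) =
    jetF k.+1 (phi^~ s) - \sum_(m < M) c m * jetF k.+1 ((psi m)^~ s).
  rewrite jetFB jetF_sum; congr (_ - _); apply: eq_bigr => m _.
  exact: jetFZ.
rewrite !E; under [in RHS]eq_bigr do rewrite mulrBr !(mulrCA (c _)).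
rewrite sumrB -!mulr_sumr; ring.
Qed.

Lemma Lam_lin N M (phi : nat -> R -> R) (psi : 'I_M -> nat -> R -> R) (c : 'I_M -> R) :
  {within `[0, 1], continuous (phi 0%N)} ->
  (forall m, {within `[0, 1], continuous (psi m 0%N)}) ->
  Lam q N (fun j t => phi j t - \sum_(m < M) c m * psi m j t) =
  Lam q N phi - \sum_(m < M) c m * Lam q N (psi m).
Proof.
move=> cphi cpsi; rewrite /Lam bdry_lin.
have cf := within_continuousM cq0 cphi.
have cg m := within_continuousM cq0 (cpsi m).
have [_ E] := Int01_lin c cf cg.
have -> : (fun t => q 0 t * (phi 0 t - \sum_(m < M) c m * psi m 0 t)) =
    (fun t => q 0 t * phi 0 t - \sum_(m < M) c m * (q 0 t * psi m 0 t)).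
  apply/funext => t; rewrite mulrBr mulr_sumr; congr (_ - _).
  by apply: eq_bigr => m _; rewrite mulrCA.
rewrite E; under [in RHS]eq_bigr do rewrite mulrDr.
by rewrite big_split /=; ring.
Qed.

End half_line_bounds.

(** * Continuation in y, from y = 24 down towards the real axis *)

Section half_line_poisson.
Context {R : realType} (q : nat -> R -> R) (B rho : R).
Hypothesis rho_gt0 : 0 < rho.
Hypothesis rho_lt1 : rho < 1.
Hypothesis cq0 : {within `[0, 1], continuous (q 0)}.
Hypothesis Dq : forall k, deriv_on 0 1 (q k.+1) (fun t => q k.+2 t - q k t).
Hypothesis q_le : forall k t, t \in `[0, 1] -> `|q k t| <= B.
Hypothesis q0_le : forall k, `|q k 0| <= B * (rho ^+ k / k`!%:R).
Hypothesis q1_le : forall k, `|q k 1| <= B * (rho ^+ k / k`!%:R).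
Variable x : R.
Hypothesis rho_x : rho < x.
Hypothesis x_rho : x < 1 - rho.

Let B_ge0 : 0 <= B.
Proof.
apply: le_trans (normr_ge0 _) (q_le 0 (_ : 0 \in `[0, 1])).
by rewrite in_itv/= lexx ler01.
Qed.

Definition kjet n th y (j : nat) (t : R) : R := ker x (n + j) th t y.

Lemma deriv_on_kjet n th (y : R) j : 0 < y ->
  deriv_on 0 1 (kjet n th y j) (kjet n th y j.+1).
Proof.
move=> y0; apply: deriv_on_full => t _; rewrite /kjet addnS.
by apply: is_derive_ker_s; rewrite ltr_wpDl ?sqr_ge0// exprn_gt0.
Qed.

(** The interior terms disappear in the limit, so Green's identity holds with the full boundary
    series. All [n] and [th] are included because the Taylor coefficients in y of one kernel are
    kernels with other [n] and [th]. *)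
Definition good (y : R) := forall n th,
  Lam q N (kjet n th y) @[N --> \oo] --> (0 : R).

(** At this height every real point is at distance at least 24 = 12 + 12 from the pole: one half
    pays for the [n] derivatives, the other is the jet radius that [Lam_small] asks for. *)
Lemma good24 : good 24.
Proof.
move=> n th; rewrite -cvg_shiftS.
pose K : R := n`!%:R / 12 ^+ n.
have K0 : 0 <= K by rewrite divr_ge0// exprn_ge0.
have H N : `|Lam q N.+1 (kjet n th 24)| <= 10 * B * K * jetE 12 * 4^-1 ^+ N.
  apply: (Lam_small rho_gt0 rho_lt1 cq0 Dq q_le q0_le).
    by move=> j; exact: deriv_on_kjet.
  move=> j t _; apply: le_trans (ker_le (r := 24) _ _ _ _) _ => //.
    by rewrite lerDr sqr_ge0.
  have := @fact_exp_binom R 12 12 n j (ltr0n _ 12) (ltr0n _ 12).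
  have -> : 12 + 12 = 24 :> R by lra.
  apply: le_trans; rewrite exprS invfM mulrCA ler_piMl//.
  lra.
have cz : (10 * B * K * jetE 12 * 4^-1 ^+ N) @[N --> \oo] --> (0 : R).
  rewrite -[X in _ --> X](mulr0 (10 * B * K * jetE 12)).
  apply: cvgM; first exact: cvg_cst.
  by apply: cvg_expr; rewrite ger0_norm; lra.
apply: norm_cvg0.
apply: (squeeze_cvgr _ (cvg_cst 0) cz).
by near=> N; rewrite normr_ge0 H.
Unshelve. all: by end_near. Qed.

(* Taylor expansion in y around y1: the remainder is small as a jet at 0 and 1
   with radius rho + k > rho, hence under Lam, uniformly in N. *)
Lemma good_step (k y1 y : R) : 0 < k -> rho + 2 * k < x -> x < 1 - rho - 2 * k ->
  2 * k <= y -> y <= y1 -> y1 - y <= k / 4 -> good y1 -> good y.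
Proof.
move=> k0 kx xk ky yy1 y1y gy1 n th.
have rho0 : 0 < rho by exact: rho_gt0.
have y0 : 0 < y by lra.
have y10 : 0 < y1 by lra.
(* The points x + iz are at distance at least rho + 2k = r + k from 0 and 1: [r] is the radius of
   the jet, and the spare [k] pays for the derivatives in y. *)
pose r := rho + k.
have r0 : 0 < r by exact: addr_gt0.
have rhor : rho < r by rewrite /r; lra.
have r1 : r <= 1 by rewrite /r; lra.
have [D D0 HD] := bdry_le B_ge0 rho_gt0 rho_lt1 q0_le q1_le rhor r1.
(* The spare radius k is halved between the [n] given derivatives and the [M] Taylor derivatives; a
   step of at most k/4 against the radius k/2 gives the ratio 1/2. *)
pose K M : R := n`!%:R / (k / 2) ^+ n / k * 2^-1 ^+ M.
have K0 M : 0 <= K M.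
  by rewrite /K !mulr_ge0 ?invr_ge0 ?exprn_ge0 ?divr_ge0// ltW.
pose c m : R := (y - y1) ^+ m / m`!%:R.
pose rem M j t : R := kjet n th y j t -
  \sum_(m < M) c m * kjet (n + m) (th + 3 * m) y1 j t.
have remle M j (t s : R) : 0 < s -> (forall z, k <= z -> s ^+ 2 <= (t - x) ^+ 2 + z ^+ 2) ->
    `|rem M j t| <= (n + j + M)`!%:R / s ^+ (n + j + M).+1 * ((k / 4) ^+ M / M`!%:R).
  move=> s0 hs.
  pose f m z : R := ker x (n + j + m) (th + 3 * m) t z.
  have zk z : `|z - y1| <= k / 4 -> k <= z.
    by rewrite ler_norml => /andP[]; lra.
  have Df m z : `|z - y1| <= k / 4 -> is_derive z 1 (f m) (f m.+1 z).
    move=> /zk zk'; rewrite /f addnS mulnS (addnC 3) addnA.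
    apply: is_derive_ker_y; rewrite ltr_wpDl ?sqr_ge0// exprn_gt0//; lra.
  have fC z : `|z - y1| <= k / 4 ->
      `|f M z| <= (n + j + M)`!%:R / s ^+ (n + j + M).+1.
    by move=> /zk zk'; apply: ker_le => //; exact: hs.
  have yy : `|y - y1| <= k / 4 by rewrite ler_norml; apply/andP; split; lra.
  have := taylor_le Df fC yy.
  have -> : f 0%N y - \sum_(m < M) (y - y1) ^+ m / m`!%:R * f m y1 = rem M j t.
    rewrite /rem /kjet /f addn0 muln0 addn0; congr (_ - _).
    by apply: eq_bigr => m _; rewrite addnAC.
  move=> /le_trans; apply; rewrite ler_wpM2l//.
    by rewrite divr_ge0// exprn_ge0// ltW.
  by rewrite ler_wpM2r// lerXn2r// ?nnegrE; lra.
have half M : (n + M)`!%:R / k ^+ (n + M) * ((k / 4) ^+ M / M`!%:R) <=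
    n`!%:R / (k / 2) ^+ n * 2^-1 ^+ M.
  have k20 : 0 < k / 2 by lra.
  have := fact_exp_binom n M k20 k20.
  have -> : k / 2 + k / 2 = k by lra.
  move=> H; apply: (le_trans (ler_wpM2r _ H)).
    by rewrite divr_ge0// exprn_ge0//; lra.
  rewrite -[leLHS]mulrA; apply: ler_wpM2l.
    by rewrite divr_ge0// exprn_ge0// ltW.
  have M0 : M`!%:R != 0 :> R by rewrite pnatr_eq0 -lt0n fact_gt0.
  have -> : M`!%:R / (k / 2) ^+ M * ((k / 4) ^+ M / M`!%:R) =
      ((k / 2)^-1 * (k / 4)) ^+ M.
    rewrite [RHS]exprMn exprVn; move: ((k / 2) ^+ M)^-1 ((k / 4) ^+ M) => u v.
    by field.
  rewrite (_ : (k / 2)^-1 * (k / 4) = 2^-1)//.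
  by field; rewrite gt_eqF.
have rem_end M j (t : R) : t = 0 \/ t = 1 -> `|rem M j t| <= K M * (j`!%:R / r ^+ j).
  move=> t01; apply: (le_trans (remle M j t (r + k) _ _)); first by lra.
    move=> z zk; rewrite -[leLHS]addr0; apply: lerD; last exact: sqr_ge0.
    case: t01 => ->; first by rewrite sub0r sqrrN lerXn2r// ?nnegrE /r; lra.
    by rewrite lerXn2r// ?nnegrE /r; lra.
  have H1 := half M; have H2 := fact_exp_binom j (n + M) r0 k0.
  have rk : 0 < r + k by exact: addr_gt0.
  have J0 : 0 <= j`!%:R / r ^+ j by rewrite divr_ge0// exprn_ge0// ltW.
  have w0 : 0 <= (k / 4) ^+ M / M`!%:R.
    by rewrite divr_ge0// exprn_ge0//; lra.
  have -> : (n + j + M = j + (n + M))%N by rewrite addnAC addnC.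
  have -> : (j + (n + M))`!%:R / (r + k) ^+ (j + (n + M)).+1 =
      (r + k)^-1 * ((j + (n + M))`!%:R / (r + k) ^+ (j + (n + M))).
    by rewrite exprS invfM mulrCA.
  rewrite -[leLHS]mulrA.
  apply: (@le_trans _ _ ((r + k)^-1 * (j`!%:R / r ^+ j *
      (n`!%:R / (k / 2) ^+ n * 2^-1 ^+ M)))).
    apply: ler_wpM2l; first by rewrite invr_ge0 ltW.
    apply: (le_trans (ler_wpM2r w0 H2)).
    by rewrite -[leLHS]mulrA; exact: ler_wpM2l.
  rewrite mulrA [leRHS](_ : _ = k^-1 * (j`!%:R / r ^+ j) *
      (n`!%:R / (k / 2) ^+ n * 2^-1 ^+ M)); last by rewrite /K; ring.
  rewrite ler_wpM2r//.
    by rewrite !mulr_ge0 ?invr_ge0 ?exprn_ge0 ?divr_ge0// ltW.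
  by rewrite ler_wpM2r// lef_pV2 ?posrE// lerDr ltW.
(* Inside [0,1] the pole may lie right above t, but its height stays at least k, and only the
   function itself, not its higher jet, enters the integral. *)
have rem_in M (t : R) : `|rem M 0 t| <= K M.
  apply: (le_trans (remle M 0 t k _ _)) => //.
    by move=> z zk; rewrite ler_wpDl ?sqr_ge0// lerXn2r// ?nnegrE; lra.
  rewrite addn0.
  have -> : (n + M)`!%:R / k ^+ (n + M).+1 =
      k^-1 * ((n + M)`!%:R / k ^+ (n + M)).
    by rewrite exprS invfM mulrCA.
  rewrite -[leLHS]mulrA.
  apply: (le_trans (ler_wpM2l _ (half M))); first by rewrite invr_ge0 ltW.
  by rewrite /K; lra.
have cker n' th' (z : R) : 0 < z ->
    {within `[0, 1], continuous (kjet n' th' z 0%N)}.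
  by move=> z0; have [] := deriv_on_kjet n' th' 0 z0.
have cpsi M (m : 'I_M) : {within `[0, 1],
    continuous (kjet (n + m) (th + 3 * m) y1 0%N)} by exact: cker.
have crem M : {within `[0, 1], continuous (rem M 0%N)}.
  apply: within_continuousD; first exact: cker.
  apply: within_continuousN; apply: within_continuous_sum => m.
  by apply: within_continuousM => //; exact: within_continuous_cst.
have Lrem N M : `|Lam q N (kjet n th y) -
    \sum_(m < M) c m * Lam q N (kjet (n + m) (th + 3 * m) y1)| <= K M * (D + B).
  rewrite -(Lam_lin cq0 N (psi := fun m : 'I_M => kjet (n + m) (th + 3 * m) y1)
    (fun m : 'I_M => c m) (cker n th y y0) (cpsi M)).
  rewrite mulrDr; apply: le_trans (ler_normD _ _) _; apply: lerD.
    by apply: HD => // j; apply: rem_end; [left|right].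
  apply: (Int01q_le cq0 q_le (K0 M) (crem M)) => t _; exact: rem_in.
(* [M] is fixed first, by the bound uniform in [N]; the finitely many terms at height y1 then tend
   to 0. *)
apply/cvgr0Pnorm_le => e e0.
have [M KM] : exists M, K M * (D + B) <= e / 2.
  have cK : (K M * (D + B)) @[M --> \oo] --> (0 : R).
    rewrite -[X in _ --> X](mul0r (D + B)); apply: cvgM; last exact: cvg_cst.
    rewrite -[X in _ --> X](mulr0 (n`!%:R / (k / 2) ^+ n / k)).
    apply: cvgM; first exact: cvg_cst.
    by apply: cvg_expr; rewrite ger0_norm; lra.
  have e20 : 0 < e / 2 by lra.
  have /cvgr0Pnorm_le/(_ _ e20)[M _ /(_ M (leqnn M))] := cK.
  by move=> /(le_trans (ler_norm _)); exists M.
have cS : (\sum_(m < M) c m * Lam q N (kjet (n + m) (th + 3 * m) y1))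
    @[N --> \oo] --> (0 : R).
  rewrite -[X in _ --> X](_ : \sum_(m < M) c m * 0 = _); last first.
    by rewrite big1// => m _; rewrite mulr0.
  apply: cvg_big => [|m _]; first by exact: add_continuous.
  by apply: cvgM; [exact: cvg_cst|exact: gy1].
have e20 : 0 < e / 2 by lra.
have /cvgr0Pnorm_le/(_ _ e20) := cS.
apply: filterS => N SN.
have := ler_normD (Lam q N (kjet n th y) -
    \sum_(m < M) c m * Lam q N (kjet (n + m) (th + 3 * m) y1))
   (\sum_(m < M) c m * Lam q N (kjet (n + m) (th + 3 * m) y1)).
rewrite subrK => /le_trans; apply; have := Lrem N M; lra.
Qed.

Lemma good_all (y : R) : 0 < y -> y <= 1 -> good y.
Proof.
move=> y0 y1.
(* One [k] meets the constraints of [good_step] at all heights from 2k to 24, and 2k <= y; hence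
   finitely many steps of length at most k/4 suffice. *)
pose k := Num.min (y / 2) (Num.min ((x - rho) / 4) ((1 - rho - x) / 4)).
have k0 : 0 < k.
  have := rho_x; have := x_rho => h1 h2.
  by rewrite /k !lt_min; apply/and3P; split; lra.
have ky : k <= y / 2 by rewrite /k ge_min lexx.
have k1 : k <= (x - rho) / 4 by rewrite /k !ge_min lexx !orbT.
have k2 : k <= (1 - rho - x) / 4 by rewrite /k !ge_min lexx !orbT.
have H m : forall z, 2 * k <= z -> z <= 24 -> 24 - z <= m%:R * (k / 4) -> good z.
  elim: m => [|m IH] z kz z24 zm.
    by rewrite (_ : z = 24); [exact: good24|lra].
  have [z1|z1] := leP (z + k / 4) 24.
    apply: (@good_step k (z + k / 4)); try lra.
    apply: IH => //; first by lra.
    by move: zm; rewrite -natr1; lra.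
  by apply: (@good_step k 24); try lra; exact: good24.
have [m km] : exists m, 24 <= m%:R * (k / 4).
  exists (Num.truncn (24 / (k / 4))).+1.
  rewrite -ler_pdivrMr; last by lra.
  by rewrite ltW// truncnS_gt.
by apply: (H m); lra.
Qed.

(** By [good_all] the Poisson integral is the limit of minus the boundary sums. At t = 0 and t = 1
    the kernel and its derivatives in t are imaginary parts of functions that are real at y = 0, so
    a first-order Taylor bound in y yields the factor y; the derivative it costs is paid by the
    spare radius k. *)
Lemma Int01_poisson_le : exists K : R, forall y : R, 0 < y -> y <= 1 ->
  `|Int01 (fun t => q 0 t * kim x t y)| <= K * y.
Proof.
pose k := Num.min ((x - rho) / 4) ((1 - rho - x) / 4).
have rho0 : 0 < rho by exact: rho_gt0.
have k0 : 0 < k.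
  have := rho_x; have := x_rho => h1 h2.
  by rewrite /k !lt_min; apply/andP; split; lra.
have k1 : k <= (x - rho) / 4 by rewrite /k !ge_min lexx.
have k2 : k <= (1 - rho - x) / 4 by rewrite /k !ge_min lexx !orbT.
have rx : rho < x by exact: rho_x.
have xr : x < 1 - rho by exact: x_rho.
pose r := rho + k.
have r0 : 0 < r by exact: addr_gt0.
have rhor : rho < r by rewrite /r; lra.
have r1 : r <= 1 by rewrite /r; lra.
have rk : 0 < r + k by exact: addr_gt0.
have [D D0 HD] := bdry_le B_ge0 rho_gt0 rho_lt1 q0_le q1_le rhor r1.
pose K : R := k^-1 / (r + k).
have K0 : 0 <= K by apply: mulr_ge0; rewrite invr_ge0 ltW.
exists (K * D) => y y0 y1.
have kle j (t : R) : t = 0 \/ t = 1 ->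
    `|kjet 0 0 y j t| <= K * y * (j`!%:R / r ^+ j).
  move=> t01.
  have hs (z : R) : (r + k) ^+ 2 <= (t - x) ^+ 2 + z ^+ 2.
    rewrite -[leLHS]addr0; apply: lerD; last exact: sqr_ge0.
    case: t01 => ->; first by rewrite sub0r sqrrN lerXn2r// ?nnegrE /r; lra.
    by rewrite lerXn2r// ?nnegrE /r; lra.
  pose f (m : nat) (z : R) : R := ker x (j + m) (3 * m) t z.
  have Df (m : nat) (z : R) : `|z - 0| <= y -> is_derive z 1 (f m) (f m.+1 z).
    move=> _; rewrite /f addnS mulnS (addnC 3).
    by apply: is_derive_ker_y; rewrite (lt_le_trans _ (hs z))// exprn_gt0.
  have fC (z : R) : `|z - 0| <= y -> `|f 1%N z| <= (j + 1)`!%:R / (r + k) ^+ (j + 1).+1.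
    by move=> _; apply: ker_le => //; exact: hs.
  have yy : `|y - 0| <= y by rewrite subr0 ger0_norm// ltW.
  have := taylor_le Df fC yy.
  have f0 : f 0%N 0 = 0.
    have im0 m a : (pw m a 0).2 = 0 :> R.
      elim: m => //= m ->; ring.
    by rewrite /f /ker /= /kim mul0r im0 mulr0.
  rewrite big_ord1 f0 mulr0 !subr0 !expr1 divr1 (ger0_norm (ltW y0)).
  rewrite /f addn0 muln0 /kjet add0n => /le_trans; apply.
  have H2 := fact_exp_binom j 1 r0 k0.
  rewrite exprS invfM mulrCA.
  have -> : K * y * (j`!%:R / r ^+ j) =
    (r + k)^-1 * (j`!%:R / r ^+ j * (1`!%:R / k ^+ 1)) * y.
    by rewrite /K expr1 mul1r; ring.
  by rewrite ler_wpM2r ?(ltW y0)// ler_wpM2l// invr_ge0 ltW.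
have K0y : 0 <= K * y by rewrite mulr_ge0// ltW.
have HI : Int01 (fun t => q 0 t * kim x t y) =
    Int01 (fun t => q 0 t * kjet 0 0 y 0 t).
  by congr Int01; apply/funext => t; rewrite /kjet /ker /= expr0 !mul1r.
rewrite HI; apply/ler_addgt0Pr => e e0.
have := good_all y0 y1 0%N 0%N => /cvgr0Pnorm_le/(_ _ e0)[N _ /(_ N (leqnn N))].
move=> HN.
have := HD (K * y) (kjet 0 0 y) N K0y (fun j => kle j 0 (or_introl erefl))
  (fun j => kle j 1 (or_intror erefl)).
have := ler_normB (Lam q N (kjet 0 0 y)) (bdry q N (kjet 0 0 y)).
rewrite {1}/Lam addrAC subrr add0r; lra.
Qed.

End half_line_poisson.

(** If g(x) were positive, the window of half-width y around x would contribute a fixed positive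
    amount, while the part far from x is only O(y). This one-sided form needs no exact limit of the
    Poisson integral; applying it to -g as well gives g(x) = 0. *)
Lemma poisson_limit (R : realType) (g : R -> R) (B K x : R) :
  {within `[0, 1], continuous g} -> (forall t, t \in `[0, 1] -> `|g t| <= B) ->
  0 < x -> x < 1 ->
  (forall y : R, 0 < y -> y <= 1 -> `|Int01 (fun t => g t * kim x t y)| <= K * y) ->
  g x <= 0.
Proof.
move=> cg gB x0 x1 HK; rewrite leNgt; apply/negP => gx.
pose c := g x / 2.
have c0 : 0 < c by rewrite /c; lra.
have [e [e0 ex e1 ge]] : exists e : R, [/\ 0 < e, e <= x, x + e <= 1 &
    forall t : R, x - e <= t -> t <= x + e -> c <= g t].
  have x01 : x \in `]0, 1[ by rewrite in_itv/= x0.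
  have /(continuous_within_itvP _ ltr01)[cg' _ _] := cg.
  have /cvgrPdist_lt/(_ _ c0) := cg' x x01.
  rewrite -nbhs_nearE => /nbhs_ballP[d /= d0 dg].
  pose m := Num.min (d / 2) (Num.min x (1 - x)).
  have m0 : 0 < m by rewrite /m !lt_min; apply/and3P; split; lra.
  have md : m <= d / 2 by rewrite /m ge_min lexx.
  have mx : m <= x by rewrite /m !ge_min lexx !orbT.
  have mx1 : m <= 1 - x by rewrite /m !ge_min lexx !orbT.
  exists m; split; [by []|by []|lra|move=> t tx xt].
  have : ball x d t by rewrite /ball/= ltr_norml; apply/andP; split; lra.
  by move=> /dg /=; rewrite ltr_norml /c => /andP[]; lra.
have B0 : 0 <= B.
  apply: le_trans (normr_ge0 _) (gB x _).
  by rewrite in_itv/=; apply/andP; split; lra.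
have K0 : 0 <= K.
  by have := HK 1 ltr01 (lexx 1); rewrite mulr1; apply: le_trans.
pose S := 2 * B / e ^+ 2.
have S0 : 0 <= S by rewrite /S divr_ge0 ?sqr_ge0// mulr_ge0.
(* The bound by [e] keeps the window where g >= c, and the last entry makes (K + S) y < c,
   contradicting the lower bound c <= (K + S) y derived at the end. *)
pose y := Num.min (Num.min e 1) (c / (2 * (K + S + 1))).
have KS : 0 < K + S + 1 by lra.
have y0 : 0 < y by rewrite /y !lt_min e0 ltr01 /= divr_gt0// mulr_gt0.
have ye : y <= e by rewrite /y !ge_min lexx.
have y1 : y <= 1 by rewrite /y !ge_min lexx orbT.
have yK : y * (2 * (K + S + 1)) <= c.
  by rewrite -ler_pdivlMr ?mulr_gt0// /y ge_min lexx orbT.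
have kpos t : 0 < (t - x) ^+ 2 + y ^+ 2 by rewrite ltr_wpDl ?sqr_ge0// exprn_gt0.
have kim0 t : 0 <= kim x t y by rewrite /kim divr_ge0// ltW.
have ck : {within `[0, 1], continuous (fun t => g t * kim x t y)}.
  apply: within_continuousM => //.
  have [] := deriv_on_kjet x 0 0 0 y0.
  have -> // : kjet x 0 0 y 0 = fun t => kim x t y.
  by apply/funext => t; rewrite /kjet /ker /= expr0 !mul1r.
have [F DF FI] := Int01_primitive ck.
have far (a b : R) : 0 <= a -> a <= b -> b <= 1 ->
    (forall t, t \in `]a, b[ -> e <= `|t - x|) ->
    `|F b - F a| <= B * y / e ^+ 2 * (b - a).
  move=> a0 ab b1 ab_e.
  have DK : deriv_on a b (fun t : R => B * y / e ^+ 2 * t)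
      (fun=> B * y / e ^+ 2 * 1).
    by apply/deriv_onZ/deriv_on_full => t _; exact: is_derive_id.
  have := deriv_on_le ab (deriv_onS a0 b1 DF) DK; rewrite -mulrBr mulr1.
  apply=> t tab.
  have t01 : t \in `[0, 1].
    by move: tab; rewrite !in_itv/= => /andP[? ?]; apply/andP; split; lra.
  rewrite normrM -mulrA; apply: ler_pM => //; first exact: gB.
  rewrite ger0_norm// /kim ler_wpM2l ?(ltW y0)// lef_pV2 ?posrE ?exprn_gt0//.
  rewrite -[leLHS]addr0; apply: lerD; last exact: sqr_ge0.
  by rewrite -[leRHS]real_normK ?num_real// lerXn2r// ?nnegrE ?(ltW e0)// ab_e.
have mono (a b : R) : x - e <= a -> a <= b -> b <= x + e -> F a <= F b.
  move=> xa ab bx; apply: (deriv_on_mono ab (deriv_onS _ _ DF)); [lra|lra|].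
  move=> t; rewrite in_itv/= => /andP[ta tb]; rewrite mulr_ge0//.
  by apply: le_trans (ltW c0) (ge t _ _); lra.
(* On this window of length 2y the kernel is at least 1/(2y). *)
have center : c <= F (x + y) - F (x - y).
  have DK : deriv_on (x - y) (x + y) (fun t : R => c / (2 * y) * t)
      (fun=> c / (2 * y) * 1).
    by apply/deriv_onZ/deriv_on_full => t _; exact: is_derive_id.
  have xyxy : x - y <= x + y by lra.
  have xy0 : 0 <= x - y by lra.
  have xy1 : x + y <= 1 by lra.
  have := deriv_on_mono xyxy (deriv_onB (deriv_onS xy0 xy1 DF) DK) => /= H.
  have E : c / (2 * y) * (x + y) - c / (2 * y) * (x - y) = c.
    by field; rewrite gt_eqF.
  suff : F (x - y) - c / (2 * y) * (x - y) <= F (x + y) - c / (2 * y) * (x + y).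
    by move: E; lra.
  apply: H => t; rewrite in_itv/= => /andP[ta tb]; rewrite subr_ge0 mulr1.
  apply: ler_pM; rewrite ?invr_ge0 ?(ltW c0) ?mulr_ge0 ?(ltW y0)//.
    by apply: ge; lra.
  rewrite /kim ler_pdivlMr// mulrC ler_pdivrMr ?mulr_gt0//.
  have : (t - x) ^+ 2 <= y ^+ 2.
    rewrite -[leLHS]real_normK ?num_real// lerXn2r// ?nnegrE ?(ltW y0)//.
    by rewrite ler_norml; apply/andP; split; lra.
  by rewrite mulrCA -expr2; lra.
have l1 : `|F (x - e) - F 0| <= B * y / e ^+ 2.
  have xe0 : 0 <= x - e by lra.
  apply: le_trans (far 0 (x - e) (lexx 0) xe0 _ _) _; first lra.
    move=> t; rewrite in_itv/= => /andP[_ tx].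
    by rewrite ler0_norm; lra.
  rewrite ler_piMr//; last lra.
  by rewrite divr_ge0 ?sqr_ge0// mulr_ge0// ltW.
have l2 : `|F 1 - F (x + e)| <= B * y / e ^+ 2.
  have xe0 : 0 <= x + e by lra.
  apply: le_trans (far (x + e) 1 xe0 e1 (lexx 1) _) _.
    move=> t; rewrite in_itv/= => /andP[tx _].
    by rewrite ger0_norm; lra.
  rewrite ler_piMr//; last lra.
  by rewrite divr_ge0 ?sqr_ge0// mulr_ge0// ltW.
have m1 : F (x - e) <= F (x - y) by apply: mono; lra.
have m2 : F (x + y) <= F (x + e) by apply: mono; lra.
have := HK y y0 y1; rewrite -FI => /(le_trans (ler_norm _)) H.
have SE : B * y / e ^+ 2 + B * y / e ^+ 2 = S * y by rewrite /S; ring.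
move: l1 l2; rewrite !ler_norml => /andP[l1 _] /andP[l2 _].
have : c <= (K + S) * y by rewrite mulrDl; lra.
have : (K + S) * y * 2 < y * (2 * (K + S + 1)) by lra.
lra.
Qed.

Section half_line_zero.
Context {R : realType} (rho : R).
Hypothesis rho_gt0 : 0 < rho.
Hypothesis rho_lt1 : rho < 1.

Lemma half_line_le0 (q : nat -> R -> R) (B x : R) :
  {within `[0, 1], continuous (q 0%N)} ->
  (forall k, deriv_on 0 1 (q k.+1) (fun t => q k.+2 t - q k t)) ->
  (forall k (t : R), t \in `[0, 1] -> `|q k t| <= B) ->
  (forall k, `|q k 0| <= B * (rho ^+ k / k`!%:R)) ->
  (forall k, `|q k 1| <= B * (rho ^+ k / k`!%:R)) ->
  rho < x -> x < 1 - rho -> q 0%N x <= 0.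
Proof.
move=> cq Dq qB q0 q1 rx xr; have r0 : 0 < rho by exact: rho_gt0.
have [K HK] := Int01_poisson_le rho_gt0 rho_lt1 cq Dq qB q0 q1 rx xr.
by apply: (poisson_limit cq (qB 0%N) _ _ HK); lra.
Qed.

Lemma half_line_eq0 (q : nat -> R -> R) (B x : R) :
  {within `[0, 1], continuous (q 0%N)} ->
  (forall k, deriv_on 0 1 (q k.+1) (fun t => q k.+2 t - q k t)) ->
  (forall k (t : R), t \in `[0, 1] -> `|q k t| <= B) ->
  (forall k, `|q k 0| <= B * (rho ^+ k / k`!%:R)) ->
  (forall k, `|q k 1| <= B * (rho ^+ k / k`!%:R)) ->
  rho < x -> x < 1 - rho -> q 0%N x = 0.
Proof.
move=> cq Dq qB q0 q1 rx xr; apply/eqP; rewrite eq_le.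
rewrite (half_line_le0 cq Dq qB q0 q1 rx xr) /= -oppr_le0.
apply: (@half_line_le0 (fun k t => - q k t) B) => //.
- exact: within_continuousN.
- move=> k; apply: deriv_on_eq (deriv_onN (Dq k)) => // t _.
  by rewrite opprB opprK addrC.
- by move=> k t t01; rewrite normrN qB.
- by move=> k; rewrite normrN.
- by move=> k; rewrite normrN.
Qed.

Lemma imiD th (a b a' b' : R) :
  imi th (a + a') (b + b') = imi th a b + imi th a' b'.
Proof. by elim: th a b a' b' => //= th IH a b a' b'; rewrite opprD IH. Qed.

Lemma imi2 th (a b : R) : imi th.+2 a b = - imi th a b.
Proof. exact: imiN. Qed.

Lemma imi3 th (a b : R) : imi th.+3 a b = imi th b (- a).
Proof. by rewrite /= opprK. Qed.

Lemma deriv_on_imi th (x y : R) (f g df dg : R -> R) :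
  deriv_on x y f df -> deriv_on x y g dg ->
  deriv_on x y (fun t => imi th (f t) (g t)) (fun t => imi th (df t) (dg t)).
Proof.
elim: th f g df dg => //= th IH f g df dg Df Dg.
exact: (IH (fun t => - g t) f (fun t => - dg t) df (deriv_onN Dg) Df).
Qed.

Lemma within_continuous_imi th (x y : R) (f g : R -> R) :
  {within `[x, y], continuous f} -> {within `[x, y], continuous g} ->
  {within `[x, y], continuous (fun t => imi th (f t) (g t))}.
Proof.
elim: th f g => //= th IH f g cf cg.
exact: (IH (fun t => - g t) f (within_continuousN cg) cf).
Qed.

(* The gauge q_k = Im (i^(3k + 1 + th) e^(-2it) (X_k + i Y_k)) turns the free
   equation into the real system q_k' = q_(k+1) - q_(k-1). *)
Lemma free_half_line_eq0 (X Y : nat -> R -> R) (B x : R) :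
  {within `[0, 1], continuous (X 0%N)} -> {within `[0, 1], continuous (Y 0%N)} ->
  (forall k, deriv_on 0 1 (X k.+1)
    (fun t => - (2 * Y k.+1 t - Y k t - Y k.+2 t))) ->
  (forall k, deriv_on 0 1 (Y k.+1)
    (fun t => 2 * X k.+1 t - X k t - X k.+2 t)) ->
  (forall k (t : R), t \in `[0, 1] -> `|X k t| <= B /\ `|Y k t| <= B) ->
  (forall k (t : R), t = 0 \/ t = 1 ->
    `|X k t| <= B * (rho ^+ k / k`!%:R) /\ `|Y k t| <= B * (rho ^+ k / k`!%:R)) ->
  rho < x -> x < 1 - rho -> X 0%N x = 0 /\ Y 0%N x = 0.
Proof.
move=> cX cY DX DY XYB XY01 rx xr.
have Dc : deriv_on 0 1 (fun t : R => cos (2 * t)) (fun t => - 2 * sin (2 * t)).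
  apply: deriv_on_full => t _.
  have D2 : is_derive t 1 (fun t : R => 2 * t) 2.
    by apply: is_derive_eq; rewrite /GRing.scale /= mulr1.
  have := @is_derive1_comp _ (@cos R) (fun t : R => 2 * t) t _ _
    (is_derive_cos (2 * t)) D2.
  by rewrite mulrC mulrN -mulNr.
have Ds : deriv_on 0 1 (fun t : R => sin (2 * t)) (fun t => 2 * cos (2 * t)).
  apply: deriv_on_full => t _.
  have D2 : is_derive t 1 (fun t : R => 2 * t) 2.
    by apply: is_derive_eq; rewrite /GRing.scale /= mulr1.
  have := @is_derive1_comp _ (@sin R) (fun t : R => 2 * t) t _ _
    (is_derive_sin (2 * t)) D2.
  by rewrite mulrC.
pose Wx k t := cos (2 * t) * X k t + sin (2 * t) * Y k t.
pose Wy k t := cos (2 * t) * Y k t - sin (2 * t) * X k t.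
have DWx k : deriv_on 0 1 (Wx k.+1) (fun t => Wy k t + Wy k.+2 t).
  apply: deriv_on_eq (deriv_onD (deriv_onM Dc (DX k)) (deriv_onM Ds (DY k))) => //.
  by move=> t _; rewrite /Wy; ring.
have DWy k : deriv_on 0 1 (Wy k.+1) (fun t => - (Wx k t + Wx k.+2 t)).
  apply: deriv_on_eq (deriv_onB (deriv_onM Dc (DY k)) (deriv_onM Ds (DX k))) => //.
  by move=> t _; rewrite /Wx; ring.
pose q th k t := imi (3 * k + 1 + th)%N (Wx k t) (Wy k t).
have cW : {within `[0, 1], continuous (Wx 0%N)} /\
          {within `[0, 1], continuous (Wy 0%N)}.
  have [[cc _] [cs _]] := (Dc, Ds).
  split; first by apply: within_continuousD; exact: within_continuousM.
  apply: within_continuousD; first exact: within_continuousM.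
  by apply: within_continuousN; exact: within_continuousM.
have Wle (D : R) k t : `|X k t| <= D -> `|Y k t| <= D ->
    `|Wx k t| <= 2 * D /\ `|Wy k t| <= 2 * D.
  move=> XD YD; have c1 := cos_le1 (2 * t); have c2 := cos_geN1 (2 * t).
  have s1 := sin_le1 (2 * t); have s2 := sin_geN1 (2 * t).
  have cn : `|cos (2 * t)| <= 1 by rewrite ler_norml c2 c1.
  have sn : `|sin (2 * t)| <= 1 by rewrite ler_norml s2 s1.
  have pm (a b : R) : `|a| <= 1 -> `|b| <= D -> `|a * b| <= D.
    by move=> a1 bD; rewrite normrM -[leRHS]mul1r ler_pM.
  split.
    apply: le_trans (ler_normD _ _) _.
    by have := pm _ _ cn XD; have := pm _ _ sn YD; lra.
  apply: le_trans (ler_normB _ _) _.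
  by have := pm _ _ cn YD; have := pm _ _ sn XD; lra.
have q0 th : q th 0%N x = 0.
  apply: (@half_line_eq0 (q th) (2 * B)) => //.
  - by apply: within_continuous_imi; case: cW.
  - move=> k; apply: deriv_on_eq (deriv_on_imi (3 * k.+1 + 1 + th) (DWx k) (DWy k)) => //.
    (* Here W' = -i (W_k + W_(k+2)) with W = Wx + i Wy, and -i = i^3. The phase obtained is that of
       q_(k+2); compared with that of q_k it has an extra i^6 = -1, the source of the minus sign. *)
    move=> t _; rewrite /q -imi3 imiD.
    rewrite (_ : (3 * k.+1 + 1 + th).+3 = (3 * k.+2 + 1 + th))%N; last by lia.
    rewrite {1}(_ : (3 * k.+2 + 1 + th) = (3 * k + 1 + th).+4.+2)%N; last by lia.
    by rewrite !imi2 opprK addrC.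
  - by move=> k t /(XYB k)[Xb Yb]; have [? ?] := Wle _ _ _ Xb Yb; exact: imi_le.
  - move=> k; have [Xb Yb] := XY01 k 0 (or_introl erefl).
    by have [? ?] := Wle _ _ _ Xb Yb; rewrite -mulrA; exact: imi_le.
  - move=> k; have [Xb Yb] := XY01 k 1 (or_intror erefl).
    by have [? ?] := Wle _ _ _ Xb Yb; rewrite -mulrA; exact: imi_le.
(* At k = 0 the phases i and i^2 give the real part and minus the imaginary part. *)
have Wx0 : Wx 0%N x = 0 by exact: q0 0%N.
have Wy0 : Wy 0%N x = 0 by apply/eqP; rewrite -oppr_eq0; apply/eqP; exact: q0 1%N.
have cs := cos2Dsin2 (2 * x).
split.
- have : cos (2 * x) * Wx 0%N x - sin (2 * x) * Wy 0%N x =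
    (cos (2 * x) ^+ 2 + sin (2 * x) ^+ 2) * X 0%N x by rewrite /Wx /Wy; ring.
  by rewrite cs mul1r Wx0 Wy0 !mulr0 subr0.
- have : cos (2 * x) * Wy 0%N x + sin (2 * x) * Wx 0%N x =
    (cos (2 * x) ^+ 2 + sin (2 * x) ^+ 2) * Y 0%N x by rewrite /Wx /Wy; ring.
  by rewrite cs mul1r Wx0 Wy0 !mulr0 addr0.
Qed.

End half_line_zero.

(** * Reduction of the evolution on the web to pointwise equations *)

Section ell2_pointwise.
Context {R : realType} {A : countType}.
Implicit Types (f : A -> R[i]).

Lemma Re_le_normc (z : R[i]) : `|complex.Re z| <= normc z.
Proof. by case: z => a b /=; rewrite -sqrtr_sqr ler_wsqrtr// lerDl sqr_ge0. Qed.

Lemma Im_le_normc (z : R[i]) : `|complex.Im z| <= normc z.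
Proof. by case: z => a b /=; rewrite -sqrtr_sqr ler_wsqrtr// lerDr sqr_ge0. Qed.

Lemma normc_ge0 (z : R[i]) : 0 <= normc z.
Proof. by apply: le_trans (Re_le_normc z). Qed.

Lemma normc_le_ell2norm f a : ((normc (f a))%:E <= ell2norm f)%E.
Proof.
have H : (((normc (f a)) ^+ 2)%:E <=
    \esum_(a in [set: A]) ((normc (f a)) ^+ 2)%:E)%E.
  apply: esum_ge; exists [set a]; first by split.
  by rewrite fsbig_set1.
rewrite /ell2norm; apply: le_trans (gt0_ler_poweR _ _ _ H).
- by rewrite poweR_EFin powR12_sqrt ?sqr_ge0// sqrtr_sqr ger0_norm ?normc_ge0.
- by rewrite invr_ge0.
- by rewrite in_itv/= leey lee_fin sqr_ge0.
- by rewrite in_itv/= leey andbT esum_ge0// => ? _; rewrite lee_fin sqr_ge0.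
Qed.

Lemma ell2_bounded f : ell2 f -> exists K : R, forall a, normc (f a) <= K.
Proof.
move=> ff; exists (fine (ell2norm f)) => a.
rewrite -lee_fin fineK ?normc_le_ell2norm//.
by rewrite fin_real// ff andbT (lt_le_trans _ (poweR_ge0 _ _))// ltNyr.
Qed.

(** The norm dominates every coordinate, so a single [d] serves all vertices at once; the
    compactness argument for [C1_ell2_bounded] needs this uniformity. *)
Lemma C1_ell2_expansion (u du : R -> A -> R[i]) (t e : R) : C1_ell2 u du ->
  t \in `[0, 1] -> 0 < e -> exists2 d : R, 0 < d &
  forall s : R, s \in `[0, 1] -> `|s - t| < d -> forall a,
    `|complex.Re (u s a) - complex.Re (u t a) - (s - t) * complex.Re (du t a)|
      <= e * `|s - t| /\
    `|complex.Im (u s a) - complex.Im (u t a) - (s - t) * complex.Im (du t a)|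
      <= e * `|s - t|.
Proof.
move=> hu t01 e0.
have He : nbhs (0%E : \bar R) [set y | (y < e%:E)%E] by exact: open_ereal_lt'.
have := C1_ell2_derive hu t01 He.
rewrite /= /within /= => /nbhs_ballP[d /= d0 H].
exists d => // s s01 std a.
have [->|st] := eqVneq s t.
  by rewrite !subrr !mul0r !subr0 normr0 mulr0.
have := H s; rewrite /ball/= distrC => /(_ std st s01) Hs.
have := le_lt_trans (normc_le_ell2norm _ a) Hs.
rewrite lte_fin => /ltW.
set z := (_ * _ - _) => ze.
have st0 : s - t != 0 by rewrite subr_eq0.
have ReE : complex.Re (u s a) - complex.Re (u t a) - (s - t) * complex.Re (du t a) =
    (s - t) * complex.Re z.
  rewrite /z; case: (u s a) (u t a) (du t a) => [a1 b1] [a2 b2] [a3 b3] /=.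
  by field.
have ImE : complex.Im (u s a) - complex.Im (u t a) - (s - t) * complex.Im (du t a) =
    (s - t) * complex.Im z.
  rewrite /z; case: (u s a) (u t a) (du t a) => [a1 b1] [a2 b2] [a3 b3] /=.
  by field.
rewrite ReE ImE !normrM ![_ * `|s - t|]mulrC; split; apply: ler_wpM2l => //.
- by apply: le_trans ze; exact: Re_le_normc.
- by apply: le_trans ze; exact: Im_le_normc.
Qed.

(** The expansion at t bounds u, uniformly over the vertices, on a neighbourhood of t in [0,1];
    compactness of [0,1] makes the bound global. *)
Lemma C1_ell2_bounded (u du : R -> A -> R[i]) : C1_ell2 u du ->
  exists B : R, forall (t : R) a, t \in `[0, 1] ->
    `|complex.Re (u t a)| <= B /\ `|complex.Im (u t a)| <= B.
Proof.
move=> hu.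
have cK := @segment_compact R 0 1.
have /(compact_near_coveringP _)/(_ R (pinfty_nbhs R) (fun B t => t \in `[0, 1] ->
  forall a, `|complex.Re (u t a)| <= B /\ `|complex.Im (u t a)| <= B)) := cK.
case.
- move=> t t01.
  have [K HK] := ell2_bounded (C1_ell2_val hu t01).
  have [K' HK'] := ell2_bounded (C1_ell2_dval hu t01).
  have [d d0 Hd] := C1_ell2_expansion hu t01 ltr01.
  pose b := K + K' + 1.
  exists (ball t (Num.min d 1), [set x | b < x]).
    split; first by apply: nbhsx_ballx; rewrite lt_min d0 ltr01.
    by exists b; split=> //; exact: num_real.
  move=> [s B] [/= ts bB] s01 a.
  have [td t1] : `|s - t| < d /\ `|s - t| < 1.
    by move: ts; rewrite /ball/= distrC lt_min => /andP[].
  have [H1 H2] := Hd s s01 td a.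
  have aux (x y z : R) : `|y| <= K -> `|z| <= K' ->
      `|x - y - (s - t) * z| <= 1 * `|s - t| -> `|x| <= B.
    move=> yK zK' H.
    have -> : x = x - y - (s - t) * z + (y + (s - t) * z) by ring.
    apply: le_trans (ler_normD _ _) _.
    have h1 := ler_normD y ((s - t) * z).
    have h2 : `|(s - t) * z| <= K'.
      by rewrite normrM -[leRHS]mul1r ler_pM// ltW.
    rewrite /b in bB; lra.
  split; [apply: aux H1|apply: aux H2].
  + exact: le_trans (Re_le_normc _) (HK a).
  + exact: le_trans (Re_le_normc _) (HK' a).
  + exact: le_trans (Im_le_normc _) (HK a).
  + exact: le_trans (Im_le_normc _) (HK' a).
- move=> M [_ HM]; exists (M + 1) => t a t01.
  by apply: HM => //; rewrite ltrDl.
Qed.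

Lemma deriv_on_expansion (f df : R -> R) :
  (forall t e : R, t \in `[0, 1] -> 0 < e -> exists2 d : R, 0 < d &
     forall s : R, s \in `[0, 1] -> `|s - t| < d ->
       `|f s - f t - (s - t) * df t| <= e * `|s - t|) ->
  deriv_on 0 1 f df.
Proof.
move=> H; split.
  apply/subspace_continuousP => t t01; apply/cvgrPdist_le => e e0.
  have [d d0 Hd] := H t 1 t01 ltr01.
  pose c := 1 + `|df t|.
  have c0 : 0 < c by rewrite ltr_pwDl.
  rewrite /within /=; apply/nbhs_ballP; exists (Num.min d (e / c)) => /=.
    by rewrite lt_min d0 divr_gt0.
  move=> s; rewrite /ball/= distrC lt_min => /andP[sd se] s01.
  have := Hd s s01 sd; rewrite mul1r => h.
  have -> : f t - f s = - (f s - f t - (s - t) * df t) - (s - t) * df t by ring.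
  apply: le_trans (ler_normB _ _) _; rewrite normrN normrM.
  apply: le_trans (lerD h (lexx _)) _.
  have -> : `|s - t| + `|s - t| * `|df t| = `|s - t| * c by rewrite /c; ring.
  by rewrite -ler_pdivlMr// ltW.
move=> t t01.
have D : (fun h => h^-1 *: (f (h + t) - f t)) @ 0^' --> df t.
  apply/cvgrPdist_le => e e0.
  have [d d0 Hd] := H t e (subset_itv_oo_cc t01) e0.
  move: t01; rewrite in_itv/= => /andP[t0 t1].
  rewrite near_withinE; near=> h => h0.
  have hd : `|h| < Num.min d (Num.min t (1 - t)).
    near: h; apply/nbhs_ballP; exists (Num.min d (Num.min t (1 - t))) => /=.
      by rewrite !lt_min d0 t0 subr_gt0.
    by move=> y; rewrite /ball/= sub0r normrN.
  move: hd; rewrite !lt_min => /and3P[hd ht h1].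
  have ht01 : h + t \in `[0, 1].
    move: ht h1; rewrite !ltr_norml in_itv/= => /andP[? ?] /andP[? ?].
    by apply/andP; split; lra.
  have := Hd (h + t) ht01; rewrite addrK => /(_ hd) hle.
  have -> : df t - h^-1 *: (f (h + t) - f t) =
      - (h^-1 * (f (h + t) - f t - h * df t)).
    by rewrite /GRing.scale /=; field.
  rewrite normrN normrM normfV mulrC ler_pdivrMr ?normr_gt0//.
have D' : (fun h => h^-1 *: (f (h *: (1 : R) + t) - f t)) @ 0^' --> df t.
  by under eq_fun do rewrite /GRing.scale /= mulr1; exact: D.
apply: DeriveDef; first by apply/cvg_ex; exists (df t).
exact/cvg_lim.
Unshelve. all: by end_near. Qed.

End ell2_pointwise.

(** * Rows of the web matrix *)

Section rows.
Context {R : realType} {A : countType}.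

Lemma esum_seq (s : seq A) (h : A -> R) : uniq s -> (forall a, 0 <= h a) ->
  (forall a, a \notin s -> h a = 0) ->
  (\esum_(a in [set: A]) (h a)%:E = (\sum_(a <- s) h a)%:E)%E.
Proof.
move=> us h0 hs.
have -> : (\esum_(a in [set: A]) (h a)%:E =
    \esum_(a in [set` s]) (h a)%:E)%E.
  rewrite [RHS]esum_mkcond; apply: eq_esum => a _.
  case: ifPn => //; rewrite notin_setE /= => /negP /hs ->.
  by [].
rewrite (esum_fset (finite_seq s)); last by move=> a _; rewrite lee_fin.
by rewrite -fsbig_seq// sumEFin.
Qed.

Lemma rsum_seq (s : seq A) (h : A -> R) : uniq s ->
  (forall a, a \notin s -> h a = 0) -> rsum h = \sum_(a <- s) h a.
Proof.
move=> us hs; rewrite /rsum !(@esum_seq s)//=.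
- rewrite -sumrB; apply: eq_bigr => a _.
  rewrite /Num.max; case: ifPn; case: ifPn; lra.
- by move=> a; rewrite le_max lexx orbT.
- by move=> a /hs ->; rewrite oppr0 maxxx.
- by move=> a; rewrite le_max lexx orbT.
- by move=> a /hs ->; rewrite maxxx.
Qed.

Lemma Re_csum_real (c : A -> R) (f : A -> R[i]) :
  complex.Re (csum (fun b => (c b)%:C * f b)) = rsum (fun b => c b * complex.Re (f b)).
Proof.
rewrite /csum /=; congr rsum; apply/funext => b.
by case: (f b) => x y /=; rewrite mul0r subr0.
Qed.

Lemma Im_csum_real (c : A -> R) (f : A -> R[i]) :
  complex.Im (csum (fun b => (c b)%:C * f b)) = rsum (fun b => c b * complex.Im (f b)).
Proof.
rewrite /csum /=; congr rsum; apply/funext => b.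
by case: (f b) => x y /=; rewrite mul0r addr0.
Qed.

Variables (L : A -> A -> R) (N : nat) (nu : 'I_N -> nat -> A).
Hypothesis hweb : web_like L nu.

Lemma channel_row c k b : (0 < k)%N -> L (nu c k) b != 0 ->
  b \in [:: nu c k.-1; nu c k; nu c k.+1].
Proof.
move=> k0 Lb; rewrite !inE.
have [->|nb] := eqVneq b (nu c k); first by rewrite orbT.
have : edge L (nu c k) b by rewrite /edge eq_sym nb.
by move=> /(web_channel hweb c k0)[] ->; rewrite eqxx ?orbT.
Qed.

Lemma channel_uniq c k : (0 < k)%N -> uniq [:: nu c k.-1; nu c k; nu c k.+1].
Proof.
move=> k0.
have e1 : edge L (nu c k) (nu c k.-1) by apply/(web_channel hweb c k0); left.
have e2 : edge L (nu c k) (nu c k.+1) by apply/(web_channel hweb c k0); right.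
have [n1 _] := andP e1; have [n2 _] := andP e2.
rewrite /= !inE negb_or eq_sym n1 n2 /= andbT.
(* Distinctness is known only for positive indices; for k = 1 the two neighbours differ because one
   is a core vertex and the other is not. *)
apply/eqP => E; case: k k0 {e1 e2 n1 n2} E => // -[|k] _ /= E.
  have H : ~ channel_vertices nu (nu c 0%N) by exact: (web_core_root hweb).
  by apply: H; exists c, 2%N.
by have [_] := web_distinct hweb (ltn0Sn _) (ltn0Sn _) E; lia.
Qed.

Lemma web_coef_bounded : exists K : R, 0 <= K /\ forall c k,
  `|L (nu c k) (nu c k)| <= K /\ `|L (nu c k) (nu c k.+1)| <= K.
Proof.
have [K0 [_ HK]] := web_free hweb.
pose S : R := \sum_(c < N) \sum_(k < K0)
  (`|L (nu c k) (nu c k)| + `|L (nu c k) (nu c k.+1)|).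
have S0 : 0 <= S by rewrite /S; do 2 (apply: sumr_ge0 => ? _); rewrite addr_ge0.
exists (S + 2); split; first by lra.
move=> c k; have [k0|k0] := leqP K0 k.
  have [hb ha] := HK c k k0; rewrite /web_a /web_b in hb ha; rewrite ha.
  have -> : L (nu c k) (nu c k.+1) = - 1 by rewrite -hb opprK.
  by rewrite normrN !ger0_norm//; split; lra.
suff : `|L (nu c k) (nu c k)| + `|L (nu c k) (nu c k.+1)| <= S.
  move=> h; have h1 := normr_ge0 (L (nu c k) (nu c k)).
  by have h2 := normr_ge0 (L (nu c k) (nu c k.+1)); split; lra.
rewrite /S (bigD1 c)//= (bigD1 (Ordinal k0))//= -addrA lerDl addr_ge0//.
  by apply: sumr_ge0 => ? _; rewrite addr_ge0.
by do 2 (apply: sumr_ge0 => ? _); rewrite addr_ge0.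
Qed.

(** A channel row has three entries, uniformly bounded because the coefficients are eventually
    constant; a core row lives on the finite core and the first channel vertices. Finite support
    turns [rsum] into a finite sum, and the bound makes L act boundedly in the sup norm. *)
Lemma web_row_bounded : exists K : R, 0 <= K /\ forall a, exists s : seq A,
  [/\ uniq s, forall b, b \notin s -> L a b = 0 & \sum_(b <- s) `|L a b| <= K].
Proof.
have [K [K0 HK]] := web_coef_bounded.
have /finite_seqP[cs Hcs] := web_core_finite hweb.
pose s0 := undup (cs ++ [seq nu c 1 | c <- enum 'I_N]).
pose S : R := \sum_(a <- undup cs) \sum_(b <- s0) `|L a b|.
have S0 : 0 <= S by rewrite /S; do 2 (apply: sumr_ge0 => ? _).
exists (S + 3 * K); split; first by lra.
move=> a; have [|aC] := pselect (core_vertices nu a).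
  move=> aC; exists s0; split.
  - exact: undup_uniq.
  - move=> b; apply: contraNeq => Lab; rewrite mem_undup mem_cat.
    have [bC|bC] := pselect (core_vertices nu b).
      by move: bC; rewrite Hcs /= => ->.
    have [c [_ ->]] := web_core_link hweb aC (contrapT bC) Lab.
    by rewrite orbC map_f// mem_enum.
  - apply: (@le_trans _ _ S); last lra.
    have acs : a \in undup cs by rewrite mem_undup; move: aC; rewrite Hcs.
    rewrite /S [leRHS](bigD1_seq a)//= ?undup_uniq// lerDl.
    by do 2 (apply: sumr_ge0 => ? _).
have [c [k [k0 ->]]] := contrapT aC.
exists [:: nu c k.-1; nu c k; nu c k.+1]; split.
- exact: channel_uniq.
- by move=> b; apply: contraNeq; exact: channel_row.
- rewrite !big_cons big_nil addr0.
  have [h1 h2] := HK c k; have [_ h3] := HK c k.-1.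
  rewrite prednK// (web_sym hweb) in h3.
  lra.
Qed.

End rows.

(** * Uniqueness on the channel *)

Section uniqueness_tools.
Context {R : realType}.

Lemma deriv_on_zero (a b : R) (f df : R -> R) : 0 <= a -> b <= 1 ->
  deriv_on 0 1 f df -> (forall t : R, a < t -> t < b -> f t = 0) ->
  forall t : R, a < t -> t < b -> df t = 0.
Proof.
move=> a0 b1 [_ Df] f0 t at_ tb.
have tI : t \in `]0, 1[ by rewrite in_itv/=; apply/andP; split; lra.
have tab : t \in `]a, b[ by rewrite in_itv/= at_ tb.
have Hn : \near t, f t = (cst 0 : R -> R) t.
  near=> s; have : s \in `]a, b[ by near: s; exact: near_in_itvoo.
  by rewrite in_itv/= => /andP[? ?]; rewrite f0.
have D0 := near_eq_is_derive Hn (Df t tI).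
by have := @derive_val _ _ _ _ _ _ _ D0; rewrite derive_cst.
Unshelve. all: by end_near. Qed.

(** All derivatives vanish on the gap, in particular at 1/2, and the Taylor remainder there is at
    most a multiple of (K |t - 1/2|)^M/M!, which tends to 0. *)
Lemma analytic_eq0 (f : nat -> R -> R) (B K rho : R) :
  0 < rho -> rho < 2^-1 ->
  (forall n, deriv_on 0 1 (f n) (f n.+1)) ->
  (forall n (t : R), t \in `[0, 1] -> `|f n t| <= K ^+ n * B) ->
  (forall t : R, rho < t -> t < 1 - rho -> f 0%N t = 0) ->
  forall t : R, t \in `[0, 1] -> f 0%N t = 0.
Proof.
move=> rho0 rho1 Df fB f0.
have fn0 n : forall t : R, rho < t -> t < 1 - rho -> f n t = 0.
  elim: n => // n IH; apply: deriv_on_zero (Df n) IH; lra.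
have inner n (t : R) : 0 < t -> t < 1 -> f n t = 0.
  move=> t0 t1; pose h : R := 2^-1.
  have zI z : `|z - h| <= `|t - h| -> z \in `]0, 1[.
    move=> zt; have : `|z - h| < h.
      apply: le_lt_trans zt _; rewrite ltr_norml /h; apply/andP; split; lra.
    by rewrite ltr_norml /h in_itv/= => /andP[? ?]; apply/andP; split; lra.
  have HM M : `|f n t| <= K ^+ n * B * exp_coeff (K * `|t - h|) M.
    have Df' m z : `|z - h| <= `|t - h| ->
        is_derive z 1 (f (n + m)%N) (f (n + m.+1)%N z).
      by move=> /zI zI'; rewrite addnS; have [_] := Df (n + m)%N; exact.
    have fC z : `|z - h| <= `|t - h| -> `|f (n + M)%N z| <= K ^+ (n + M) * B.
      by move=> /zI/subset_itv_oo_cc; exact: fB.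
    have := taylor_le Df' fC (lexx _).
    rewrite big1 => [|m _]; last by rewrite fn0 ?mulr0// /h; lra.
    rewrite addn0 subr0 => /le_trans; apply.
    by rewrite /exp_coeff /= exprMn exprD le_eqVlt; apply/orP; left; apply/eqP; ring.
  have cz : (K ^+ n * B * exp_coeff (K * `|t - h|) M) @[M --> \oo] --> (0 : R).
    rewrite -[X in _ --> X](mulr0 (K ^+ n * B)).
    by apply: cvgM; [exact: cvg_cst|exact: cvg_exp_coeff].
  apply/eqP; rewrite -normr_le0; apply/ler_addgt0Pr => e e0; rewrite add0r.
  have /cvgr0Pnorm_le/(_ _ e0)[M _ /(_ M (leqnn M))] := cz.
  by move=> /(le_trans (ler_norm _)); exact: le_trans.
(* The Taylor argument covers only the open interval; 0 and 1 are reached because f is continuous up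
   to them and has zero derivative inside. *)
have edge0 (a b : R) : 0 <= a -> a <= b -> b <= 1 -> f 0%N b = f 0%N a.
  move=> a0 ab b1.
  have := deriv_on_le ab (deriv_onS a0 b1 (Df 0%N)) (deriv_on_cst a b 0).
  rewrite subrr normr_le0 subr_eq0 => H; apply/eqP; apply: H => t.
  rewrite in_itv/= => /andP[ta tb].
  by rewrite inner ?normr0//; lra.
move=> t; rewrite in_itv/= => /andP[t0 t1].
have h2 : f 0%N 2^-1 = 0 by apply: f0; lra.
have [th|th] := leP t 2^-1.
  by rewrite -(edge0 t 2^-1) //; lra.
by rewrite (edge0 2^-1 t) //; lra.
Qed.

(** The weak Stirling bound n! <= e n (n/e)^n at [n.+1]. The induction step is e (n+1)^(n+2) <=
    (n+2)^(n+2), which follows from 1 - 1/(n+2) <= exp(-1/(n+2)). *)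
Lemma fact_le_expn n : expR 1 ^+ n.+1 * n.+1`!%:R <= expR 1 * n.+1%:R ^+ n.+2 :> R.
Proof.
elim: n => [|n IH]; first by rewrite expr1 mulr1 expr1n mulr1.
have n20 : 0 < n.+2%:R :> R by rewrite ltr0n.
have H : expR 1 * n.+1%:R ^+ n.+2 <= n.+2%:R ^+ n.+2 :> R.
  have h1 : n.+1%:R / n.+2%:R <= expR (- n.+2%:R^-1) :> R.
    apply: le_trans (expR_ge1Dx _).
    rewrite ler_pdivrMr// mulrDl mul1r mulNr mulVf ?gt_eqF//.
    by rewrite -[n.+2%:R]natr1 addrK.
  have h2 : (n.+1%:R / n.+2%:R) ^+ n.+2 <= expR (- 1) :> R.
    have -> : (-1 : R) = n.+2%:R * - n.+2%:R^-1.
      by rewrite mulrN divff// gt_eqF.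
    by rewrite expRM_natl lerXn2r// nnegrE ?expR_ge0// divr_ge0.
  move: h2; rewrite expr_div_n expRN ler_pdivrMr ?exprn_gt0//.
  by rewrite mulrC ler_pdivlMr ?expR_gt0// mulrC.
rewrite exprS factS natrM [n.+2%:R ^+ n.+3]exprS.
have -> : expR 1 * expR 1 ^+ n.+1 * (n.+2%:R * n.+1`!%:R) =
    expR 1 * n.+2%:R * (expR 1 ^+ n.+1 * n.+1`!%:R) :> R by ring.
apply: (@le_trans _ _ (expR 1 * n.+2%:R * (expR 1 * n.+1%:R ^+ n.+2))).
  by rewrite ler_wpM2l// mulr_ge0// expR_ge0.
by rewrite -[leLHS]mulrA ler_wpM2l ?expR_ge0// ler_wpM2l.
Qed.

(** Stirling turns the decay into c^(m+k)/(m+k)! up to a linear factor m + k, and enlarging c to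
    [rho], halfway to 1/2, absorbs that factor. [rho] does not depend on [m], so all starting
    vertices share the same gap. *)
Lemma decay_le (c : R) : 0 < c -> c < 2^-1 ->
  exists2 rho : R, 0 < rho < 2^-1 & forall m, (0 < m)%N ->
  exists2 B : R, 0 < B & forall k,
    (c * (expR 1 / (m + k)%:R)) ^+ (m + k) <= B * (rho ^+ k / k`!%:R).
Proof.
move=> c0 c1.
pose rho := (c + 2^-1) / 2.
have rc : c < rho by rewrite /rho; lra.
have rho0 : 0 < rho by lra.
exists rho; first by rewrite rho0 /rho; lra.
move=> m m0.
pose z := rho / c - 1.
have z0 : 0 < z by rewrite /z subr_gt0 ltr_pdivlMr// mul1r.
(* Bernoulli gives (rho/c)^k >= 1 + kz, and (m + 1/z)(1 + kz) >= m + k. *)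
pose B := expR 1 * (m%:R + z^-1).
have z1 : 0 < z^-1 by rewrite invr_gt0.
have mz : 0 < m%:R + z^-1 :> R by rewrite ltr_wpDl.
exists B; first by rewrite mulr_gt0// expR_gt0.
move=> k; have : (0 < m + k)%N by rewrite addn_gt0 m0.
have cm : c ^+ (m + k) <= c ^+ k.
  by rewrite exprD ler_piMl ?exprn_ge0 ?exprn_ile1// ltW//; lra.
have kf : k`!%:R <= (m + k)`!%:R :> R by rewrite ler_nat leq_fact// leq_addl.
have bern : (m + k)%:R * c ^+ k <= (m%:R + z^-1) * rho ^+ k.
  have -> : rho = c * (1 + z) by rewrite /z; field; rewrite gt_eqF.
  rewrite exprMn mulrCA mulrC; apply: ler_wpM2l; first by rewrite exprn_ge0// ltW.
  have bn : 1 + k%:R * z <= (1 + z) ^+ k.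
    elim: {cm kf} k => [|k IH]; first by rewrite mul0r addr0 expr0.
    rewrite exprS; have k0 : 0 <= k%:R :> R by [].
    have : (1 + z) * (1 + k%:R * z) <= (1 + z) * (1 + z) ^+ k.
      by apply: ler_wpM2l => //; lra.
    apply: le_trans; rewrite -natr1.
    have : 0 <= k%:R * (z * z) by rewrite !mulr_ge0// ltW.
    lra.
  apply: (@le_trans _ _ ((m%:R + z^-1) * (1 + k%:R * z))); last first.
    by apply: ler_wpM2l => //; exact: ltW.
  have -> : (m%:R + z^-1) * (1 + k%:R * z) =
      (m + k)%:R + m%:R * (k%:R * z) + z^-1 :> R.
    by rewrite natrD; field; rewrite gt_eqF.
  have : 0 <= m%:R * (k%:R * z) by rewrite !mulr_ge0// ltW.
  lra.
move: cm kf bern; case: (m + k)%N => // n cm kf bern _.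
have n1 : 0 < n.+1%:R :> R by rewrite ltr0n.
have fn : 0 < n.+1`!%:R :> R by rewrite ltr0n fact_gt0.
have fk : 0 < k`!%:R :> R by rewrite ltr0n fact_gt0.
have E1 : (expR 1 / n.+1%:R) ^+ n.+1 <= expR 1 * n.+1%:R / n.+1`!%:R :> R.
  rewrite expr_div_n ler_pdivrMr ?exprn_gt0// mulrAC ler_pdivlMr//.
  by apply: le_trans (fact_le_expn n) _; rewrite -mulrA -exprS.
rewrite exprMn; apply: (@le_trans _ _ (c ^+ k * (expR 1 * n.+1%:R / k`!%:R))).
  apply: ler_pM => //.
  - by rewrite exprn_ge0// ltW.
  - apply: le_trans E1 _; apply: ler_wpM2l; first by rewrite mulr_ge0// expR_ge0.
    by rewrite lef_pV2 ?posrE.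
have -> : c ^+ k * (expR 1 * n.+1%:R / k`!%:R) =
   expR 1 / k`!%:R * (n.+1%:R * c ^+ k) by ring.
have -> : B * (rho ^+ k / k`!%:R) =
   expR 1 / k`!%:R * ((m%:R + z^-1) * rho ^+ k) by rewrite /B; ring.
by apply: ler_wpM2l => //; rewrite divr_ge0// expR_ge0.
Qed.

End uniqueness_tools.

(** * The evolution on the web, and vanishing along the channel *)

Section evolution.
Context {R : realType} {A : countType} (L : A -> A -> R).
Variables (N : nat) (nu : 'I_N -> nat -> A).
Hypothesis hweb : web_like L nu.
Variables (u du : R -> A -> R[i]).
Hypothesis hu : C1_ell2 u du.
Hypothesis hsol : forall (t : R) (a : A), t \in `[0, 1] ->
  du t a = 'i%C * csum (fun b => (L a b)%:C * u t b).

(* Real and imaginary parts of the iterates (iL)^n u. *)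
Fixpoint iterRI n (t : R) : (A -> R) * (A -> R) :=
  if n is n1.+1 then
    (fun a => - rsum (fun b => L a b * (iterRI n1 t).2 b),
     fun a => rsum (fun b => L a b * (iterRI n1 t).1 b))
  else (fun a => complex.Re (u t a), fun a => complex.Im (u t a)).

(** Rows are finite sums, so differentiation commutes with L coordinatewise and u, assumed only C^1,
    has time derivatives of all orders at each vertex. *)
Lemma deriv_on_iterRI n a :
  deriv_on 0 1 (fun t => (iterRI n t).1 a) (fun t => (iterRI n.+1 t).1 a) /\
  deriv_on 0 1 (fun t => (iterRI n t).2 a) (fun t => (iterRI n.+1 t).2 a).
Proof.
elim: n a => [|n IH] a.
  have ReE t : t \in `]0, 1[ -> complex.Re (du t a) = (iterRI 1 t).1 a.
    move=> /subset_itv_oo_cc t01; rewrite hsol// [RHS]/= -Im_csum_real.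
    by move: (csum _) => [x y] /=; rewrite mul0r mul1r sub0r.
  have ImE t : t \in `]0, 1[ -> complex.Im (du t a) = (iterRI 1 t).2 a.
    move=> /subset_itv_oo_cc t01; rewrite hsol// [RHS]/= -Re_csum_real.
    by move: (csum _) => [x y] /=; rewrite mul0r mul1r add0r.
  split.
  - have D : deriv_on 0 1 (fun t => complex.Re (u t a)) (fun t => complex.Re (du t a)).
      apply: deriv_on_expansion => t e t01 e0.
      have [d d0 H] := C1_ell2_expansion hu t01 e0.
      by exists d => // s s01 st; have [] := H s s01 st a.
    exact: deriv_on_eq ReE D.
  - have D : deriv_on 0 1 (fun t => complex.Im (u t a)) (fun t => complex.Im (du t a)).
      apply: deriv_on_expansion => t e t01 e0.
      have [d d0 H] := C1_ell2_expansion hu t01 e0.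
      by exists d => // s s01 st; have [] := H s s01 st a.
    exact: deriv_on_eq ImE D.
have [K [K0 HK]] := web_row_bounded hweb.
have [s [us sL _]] := HK a.
have E (g : A -> R) : rsum (fun b => L a b * g b) = \sum_(b <- s) L a b * g b.
  by apply: rsum_seq => // b /sL ->; rewrite mul0r.
split.
- have D := deriv_onN (deriv_on_sum s (fun b => deriv_onZ (L a b) (IH b).2)).
  by apply: deriv_on_eq D => [t|t _]; rewrite [in RHS]/= -E.
- have D := deriv_on_sum s (fun b => deriv_onZ (L a b) (IH b).1).
  by apply: deriv_on_eq D => [t|t _]; rewrite [in RHS]/= -E.
Qed.

Lemma iterRI_bounded : exists K B : R, 0 <= B /\
  forall n (t : R) a, t \in `[0, 1] ->
  `|(iterRI n t).1 a| <= K ^+ n * B /\ `|(iterRI n t).2 a| <= K ^+ n * B.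
Proof.
have [K [K0 HK]] := web_row_bounded hweb.
have [B HB] := C1_ell2_bounded hu.
exists K, `|B|; split=> // n t a t01; elim: n a => [|n IH] a.
  by have [h1 h2] := HB t a t01; rewrite expr0 mul1r; split;
    apply: le_trans (ler_norm B).
have [s [us sL sK]] := HK a.
have bound (g : A -> R) : (forall b, `|g b| <= K ^+ n * `|B|) ->
    `|rsum (fun b => L a b * g b)| <= K ^+ n.+1 * `|B|.
  move=> gb; rewrite (@rsum_seq _ _ s)//; last by move=> b /sL ->; rewrite mul0r.
  apply: le_trans (ler_norm_sum _ _ _) _.
  apply: (@le_trans _ _ (\sum_(b <- s) `|L a b| * (K ^+ n * `|B|))).
    by apply: ler_sum => b _; rewrite normrM ler_wpM2l.
  rewrite -mulr_suml exprS -mulrA ler_wpM2r// mulr_ge0// exprn_ge0//.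
by split=> /=; rewrite ?normrN; apply: bound => b; have [] := IH b.
Qed.

Lemma rsum_channel c k (g : A -> R) :
  rsum (fun b => L (nu c k.+1) b * g b) =
  L (nu c k.+1) (nu c k) * g (nu c k) +
  L (nu c k.+1) (nu c k.+1) * g (nu c k.+1) +
  L (nu c k.+1) (nu c k.+2) * g (nu c k.+2).
Proof.
rewrite (rsum_seq (channel_uniq hweb c (ltn0Sn k))) => [|b].
  by rewrite !big_cons big_nil addr0 addrA.
move=> bs; have [->|Lb] := eqVneq (L (nu c k.+1) b) 0; first by rewrite mul0r.
by rewrite (channel_row hweb (ltn0Sn k) Lb) in bs.
Qed.

Variable c : 'I_N.

(** Only the boundary vertex of the half-line is shown to vanish; since every vertex beyond the
    perturbed region can serve as the boundary, the whole tail follows. *)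
Lemma channel_tail_eq0 (K0 : nat) (B rho : R) :
  0 < rho -> rho < 2^-1 -> (0 < K0)%N ->
  (forall k, (K0 <= k)%N -> web_b L nu c k = 1 /\ web_a L nu c k = 2) ->
  (forall k (t : R), t = 0 \/ t = 1 ->
     normc (u t (nu c (K0 + k))) <= B * (rho ^+ k / k`!%:R)) ->
  forall t : R, rho < t -> t < 1 - rho ->
  (iterRI 0 t).1 (nu c K0) = 0 /\ (iterRI 0 t).2 (nu c K0) = 0.
Proof.
move=> rho0 rho1 K00 hfree hB t rt tr.
have [K [B' [B'0 HB']]] := iterRI_bounded.
have rhoL1 : rho < 1 by lra.
pose X k (t : R) := (iterRI 0 t).1 (nu c (K0 + k)).
pose Y k (t : R) := (iterRI 0 t).2 (nu c (K0 + k)).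
suff : X 0%N t = 0 /\ Y 0%N t = 0 by rewrite /X /Y addn0.
have w0 k : 0 <= rho ^+ k / k`!%:R by rewrite divr_ge0// exprn_ge0// ltW.
have B0 : 0 <= B.
  have := hB 0%N 0 (or_introl erefl).
  by rewrite expr0 divr1 mulr1; apply: le_trans; exact: normc_ge0.
(* The half-line lemma takes one constant for both the uniform bound and the decay at the
   endpoints. *)
have BB (k : nat) (x : R) : 0 <= x -> B * x <= (B + B') * x.
  by move=> x0; rewrite ler_wpM2r// lerDl.
have rowX k (s : R) : (iterRI 1 s).1 (nu c (K0 + k.+1)) =
    - (2 * Y k.+1 s - Y k s - Y k.+2 s).
  rewrite /Y /= !addnS rsum_channel.
  have [] := hfree (K0 + k)%N (leq_addr _ _).
  have [] := hfree (K0 + k).+1 (leqW (leq_addr _ _)).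
  rewrite /web_a /web_b => hb1 -> hb0 _.
  rewrite (web_sym hweb _ (nu c (K0 + k))).
  have -> : L (nu c (K0 + k)) (nu c (K0 + k).+1) = - 1 by rewrite -hb0 opprK.
  have -> : L (nu c (K0 + k).+1) (nu c (K0 + k).+2) = - 1 by rewrite -hb1 opprK.
  by ring.
have rowY k (s : R) : (iterRI 1 s).2 (nu c (K0 + k.+1)) =
    2 * X k.+1 s - X k s - X k.+2 s.
  rewrite /X /= !addnS rsum_channel.
  have [] := hfree (K0 + k)%N (leq_addr _ _).
  have [] := hfree (K0 + k).+1 (leqW (leq_addr _ _)).
  rewrite /web_a /web_b => hb1 -> hb0 _.
  rewrite (web_sym hweb _ (nu c (K0 + k))).
  have -> : L (nu c (K0 + k)) (nu c (K0 + k).+1) = - 1 by rewrite -hb0 opprK.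
  have -> : L (nu c (K0 + k).+1) (nu c (K0 + k).+2) = - 1 by rewrite -hb1 opprK.
  by ring.
apply: (free_half_line_eq0 rho0 rhoL1 (B := B + B')) rt tr.
- by have [[]] := deriv_on_iterRI 0 (nu c (K0 + 0)).
- by have [_ []] := deriv_on_iterRI 0 (nu c (K0 + 0)).
- move=> k; have [D _] := deriv_on_iterRI 0 (nu c (K0 + k.+1)).
  by apply: deriv_on_eq D => // s _; exact: rowX.
- move=> k; have [_ D] := deriv_on_iterRI 0 (nu c (K0 + k.+1)).
  by apply: deriv_on_eq D => // s _; exact: rowY.
- move=> k s s01; have [h1 h2] := HB' 0%N s (nu c (K0 + k)) s01.
  rewrite expr0 mul1r in h1 h2.
  by split; [apply: le_trans h1 _|apply: le_trans h2 _]; rewrite lerDr.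
- move=> k s s01; have h := le_trans (hB k s s01) (BB k _ (w0 k)).
  by split; apply: le_trans h; [exact: Re_le_normc|exact: Im_le_normc].
Qed.

Lemma channel_descent (rho : R) (m : nat) : 0 < rho -> rho < 2^-1 ->
  (forall k (t : R), (m <= k)%N -> rho < t -> t < 1 - rho ->
    (iterRI 0 t).1 (nu c k) = 0 /\ (iterRI 0 t).2 (nu c k) = 0) ->
  forall k (t : R), rho < t -> t < 1 - rho ->
    (iterRI 0 t).1 (nu c k) = 0 /\ (iterRI 0 t).2 (nu c k) = 0.
Proof.
move=> rho0 rho1; elim: m => [|m IH] H k t rt tr; first exact: H.
apply: IH => // {k t rt tr} k t + rt tr.
rewrite leq_eqVlt => /predU1P[<-{k}|mk]; last exact: H.
have L0 : L (nu c m.+1) (nu c m) != 0.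
  have : edge L (nu c m.+1) (nu c m) by apply/(web_channel hweb c (ltn0Sn m)); left.
  by case/andP.
have [D1 D2] := deriv_on_iterRI 0 (nu c m.+1).
have r0 : 0 <= rho by exact: ltW.
have r1 : 1 - rho <= 1 by lra.
have [h1 h1'] := H m.+1 t (leqnn _) rt tr.
have [h2 h2'] := H m.+2 t (leqnSn _) rt tr.
have e1 := deriv_on_zero r0 r1 D1 (fun s rs sr => (H m.+1 s (leqnn _) rs sr).1) rt tr.
have e2 := deriv_on_zero r0 r1 D2 (fun s rs sr => (H m.+1 s (leqnn _) rs sr).2) rt tr.
split.
- move: e2; rewrite [LHS]/= rsum_channel; rewrite /= in h1 h2 *.
  rewrite h1 h2 !mulr0 !addr0 => /eqP.
  by rewrite mulf_eq0 (negbTE L0) => /eqP.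
- move: e1; rewrite [LHS]/= rsum_channel; rewrite /= in h1' h2' *.
  rewrite h1' h2' !mulr0 !addr0 => /eqP.
  by rewrite oppr_eq0 mulf_eq0 (negbTE L0) => /eqP.
Qed.

End evolution.

Unset Implicit Arguments.

Theorem theorem3p1 (R : realType) (A : countType) (L : A -> A -> R)
    (N : nat) (nu : 'I_N -> nat -> A) (hweb : web_like L nu)
    (u du : R -> A -> R[i]) (hu : C1_ell2 u du)
    (hsol : forall (t : R) (a : A), t \in `[0, 1] ->
      du t a = 'i%C * csum (fun b => (L a b)%:C * u t b))
    (nu0 : 'I_N) (eps C : R) (heps : 0 < eps) (hC : 0 < C)
    (hdecay : forall (t : R) (k : nat), t = 0 \/ t = 1 -> (0 < k)%N ->
      normc (u t (nu nu0 k))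
        <= C * (expR 1 / ((2 + eps) * k%:R)) ^+ k) :
  forall (t : R) (k : nat), t \in `[0, 1] -> u t (nu nu0 k) = 0.
Proof.
have [K0 [K0_gt0 hfree]] := web_free hweb.
pose c := (2 + eps)^-1.
have c0 : 0 < c by rewrite invr_gt0; lra.
have c1 : c < 2^-1 by rewrite ltf_pV2 ?posrE; lra.
have [rho /andP[rho0 rho1] Hrho] := decay_le c0 c1.
(* Each m >= K0 is taken in turn as the origin of a free half-line, with the decay hypothesis read
   at m + k. *)
have tail (m : nat) (t : R) : (K0 <= m)%N -> rho < t -> t < 1 - rho ->
    (iterRI L u 0 t).1 (nu nu0 m) = 0 /\ (iterRI L u 0 t).2 (nu nu0 m) = 0.
  move=> K0m; have m0 : (0 < m)%N by exact: leq_trans K0m.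
  have [B B0 HB] := Hrho m m0; move: t.
  apply: (channel_tail_eq0 hweb hu hsol (c := nu0) (B := C * B)) => //.
    by move=> k mk; apply: hfree; exact: leq_trans mk.
  move=> k t t01; apply: le_trans (hdecay t _ t01 _) _.
    by rewrite addn_gt0 m0.
  rewrite -mulrA ler_wpM2l ?(ltW hC)//; apply: le_trans (HB k).
  by rewrite invfM /c mulrCA.
have gap := channel_descent hweb hu hsol rho0 rho1 tail.
have [K [B [_ HB]]] := iterRI_bounded hweb hu.
move=> t k t01.
have Re0 : (iterRI L u 0 t).1 (nu nu0 k) = 0.
  apply: (@analytic_eq0 _ (fun n t => (iterRI L u n t).1 (nu nu0 k)) B K rho) => //.
  - by move=> n; have [] := deriv_on_iterRI hweb hu hsol n (nu nu0 k).
  - by move=> n s s01; have [] := HB n s (nu nu0 k) s01.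
  - by move=> s rs sr; have [] := gap k s rs sr.
have Im0 : (iterRI L u 0 t).2 (nu nu0 k) = 0.
  apply: (@analytic_eq0 _ (fun n t => (iterRI L u n t).2 (nu nu0 k)) B K rho) => //.
  - by move=> n; have [] := deriv_on_iterRI hweb hu hsol n (nu nu0 k).
  - by move=> n s s01; have [] := HB n s (nu nu0 k) s01.
  - by move=> s rs sr; have [] := gap k s rs sr.
by move: Re0 Im0; rewrite /=; case: (u t (nu nu0 k)) => x y /= -> ->.
Qed.
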